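(* Let $P^W$ be the Poisson kernel of the open unit ball $B\subset\mathfrak a$ for the flat complex symmetric space $M$ of rank $d$. Let $Y_0\in\partial B$, $\Sigma'=\{\alpha\in\Sigma:\alpha(Y_0)=0\}$, $\Sigma'_+=\Sigma'\cap\Sigma^+$, $\gamma'=|\Sigma'_+|$, $\pi'(Y)=\prod_{\alpha\in\Sigma'_+}\langle\alpha,Y\rangle$, $\pi''(Y)=\prod_{\alpha\in\Sigma^+\setminus\Sigma'_+}\langle\alpha,Y\rangle$ and $\rho'=\sum_{\alpha\in\Sigma'_+}\alpha$. Then, as $X\to Y_0$ with $X\in B$, $$P^W(X,Y_0)\sim\frac{2^{2\gamma'}\,(d/2)_{\gamma'}}{|W|\,w_d\,\pi'(\rho')\,(\pi''(Y_0))^2}\;\frac{1-|X|^2}{|X-Y_0|^{2\gamma'+d}},$$ i.e. the quotient of the two sides tends to $1$.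
   Context: Setting. $G$ is a complex semisimple Lie group with maximal compact subgroup $K$ and Cartan decomposition $\mathfrak g=\mathfrak k\oplus\mathfrak p$; $M=\mathfrak p\simeq (K\rtimes\mathfrak p)/K$ is the flat complex symmetric space; $\mathfrak a\subset\mathfrak p$ is a maximal abelian subspace, $d=\dim\mathfrak a$; $\Sigma$ is the root system on $\mathfrak a$ with positive roots $\Sigma^+$ and Weyl group $W$, $\epsilon(w)=\det w$. $\langle\cdot,\cdot\rangle$ is the Killing form on $\mathfrak a$ (used to identify $\mathfrak a$ with $\mathfrak a^*$, so $\alpha(X)=\langle\alpha,X\rangle$), $|\cdot|$ its norm, and $\mathfrak a\simeq\mathbb R^d$. $\pi(X)=\prod_{\alpha\in\Sigma^+}\alpha(X)$; empty products equal $1$. $w_d=2\pi^{d/2}/\Gamma(d/2)$ is the area of the unit sphere in $\mathbb R^d$, and $(a)_n=a(a+1)\cdots(a+n-1)$ is the Pochhammer symbol, $(a)_0=1$. The Poisson kernel $P^W(X,Y)$, $X\in B$, $Y\in\partial B$, is the $W$-invariant kernel such that for $W$-invariant $f$ on $\partial B$ the function $u(X)=\int_{\partial B}f(Y)P^W(X,Y)\pi(Y)^2dY$ solves $\Delta^W u=0$ on $B$, $u=f$ on $\partial B$, where $\Delta^W u=\pi^{-1}\Delta^{\mathbb R^d}(\pi u)$. It is given by $$P^W(X,Y)=\frac{1-|X|^2}{|W|\,w_d\,\pi(X)\pi(Y)}\sum_{w\in W}\frac{\epsilon(w)}{|X-w\cdot Y|^d},$$ extended by continuity to singular $X$ or $Y$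 (those with $\pi(X)=0$ or $\pi(Y)=0$). *)

(* Defs.v *)
From HB Require Import structures.
From mathcomp Require Import all_boot all_order all_algebra finmap.
From mathcomp Require Import all_classical all_reals all_analysis.

Set Implicit Arguments.
Unset Strict Implicit.
Unset Printing Implicit Defensive.

Import Order.TTheory GRing.Theory Num.Theory.
Import numFieldNormedType.Exports.

Local Open Scope classical_set_scope.
Local Open Scope ring_scope.

(* The Cartan subspace a, with an invariant inner product such as the Killing
   form, is identified isometrically with R^d = 'cV[R]_d and its standard inner
   product; the linear form alpha is then the vector with alpha(X) = <alpha, X>.
   The norm `|X| of the library is the sup norm on 'cV[R]_d: it induces the right
   topology, but the Euclidean norm has to be [enorm]. *)
Definition dot (R : realType) (d : nat) (u v : 'cV[R]_d) : R :=
  \sum_(i < d) u i 0 * v i 0.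

Definition enorm (R : realType) (d : nat) (u : 'cV[R]_d) : R :=
  Num.sqrt (dot u u).

Definition unit_ball (R : realType) (d : nat) : set 'cV[R]_d :=
  [set X | enorm X < 1].

Definition unit_sphere (R : realType) (d : nat) : set 'cV[R]_d :=
  [set Y | enorm Y = 1].

Definition reflection (R : realType) (d : nat) (a : 'cV[R]_d) : 'M[R]_d :=
  1%:M - (2 / dot a a) *: (a *m a^T).

(* Reduced crystallographic root systems spanning R^d: these are exactly the
   root systems of complex semisimple Lie groups of rank d. *)
Record root_system (R : realType) (d : nat) (Sigma : {fset 'cV[R]_d}) : Prop :=
  RootSystem {
    root_neq0 : forall a, a \in Sigma -> a != 0;
    root_span : forall X : 'cV[R]_d,
      exists c : 'cV[R]_d -> R, X = \sum_(a <- Sigma) c a *: a;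
    root_reflection : forall a b,
      a \in Sigma -> b \in Sigma -> reflection a *m b \in Sigma;
    root_integral : forall a b,
      a \in Sigma -> b \in Sigma -> 2 * dot b a / dot a a \is a Num.int;
    root_reduced : forall a (c : R),
      a \in Sigma -> c *: a \in Sigma -> c = 1 \/ c = -1 }.

(* The roots that are positive on the Weyl chamber of a regular vector H. *)
Definition positive_roots (R : realType) (d : nat)
    (Sigma SigmaP : {fset 'cV[R]_d}) : Prop :=
  exists H : 'cV[R]_d,
    (forall a, a \in Sigma -> dot a H != 0) /\
    SigmaP = [fset a in Sigma | 0 < dot a H]%fset.

(* Products of reflections already form a group, reflections being involutions.
   It is finite, as is needed for [weyl_order] and for sums over it. *)
Definition weyl_group (R : realType) (d : nat) (Sigma : {fset 'cV[R]_d}) :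
    set 'M[R]_d :=
  [set w | exists2 s : seq 'cV[R]_d, {subset s <= Sigma} &
           w = \big[mulmx/1%:M]_(a <- s) reflection a].

Definition weyl_order (R : realType) (d : nat) (Sigma : {fset 'cV[R]_d}) : nat :=
  #|` fset_set (weyl_group Sigma)|.

Definition root_prod (R : realType) (d : nat) (S : {fset 'cV[R]_d})
    (X : 'cV[R]_d) : R :=
  \prod_(a <- S) dot a X.

Definition Gamma (R : realType) (s : R) : R :=
  \int[lebesgue_measure]_(t in `]0, +oo[) (t `^ (s - 1) * expR (- t)).

Definition sphere_area (R : realType) (d : nat) : R :=
  2 * pi `^ (d%:R / 2) / Gamma (d%:R / 2).

Definition pochhammer (R : realType) (a : R) (n : nat) : R :=
  \prod_(i < n) (a + i%:R).

Definition poisson_formula (R : realType) (d : nat)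
    (Sigma SigmaP : {fset 'cV[R]_d}) (X Y : 'cV[R]_d) : R :=
  (1 - enorm X ^+ 2) /
    ((weyl_order Sigma)%:R * sphere_area R d
       * root_prod SigmaP X * root_prod SigmaP Y)
  * \sum_(w \in weyl_group Sigma) (\det w / enorm (X - w *m Y) ^+ d).

(* Pairs at which no division by pi(X) pi(Y) = 0 occurs. *)
Definition regular_pairs (R : realType) (d : nat) (SigmaP : {fset 'cV[R]_d}) :
    set ('cV[R]_d * 'cV[R]_d) :=
  [set p | [/\ unit_ball p.1, unit_sphere p.2,
               root_prod SigmaP p.1 != 0 & root_prod SigmaP p.2 != 0]].

(* The continuous extension of [poisson_formula] to all of B x dB: at regular
   pairs the limit is the value of the formula itself. *)
Definition poisson_kernel (R : realType) (d : nat)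
    (Sigma SigmaP : {fset 'cV[R]_d}) (X Y : 'cV[R]_d) : R :=
  lim ((fun p : 'cV[R]_d * 'cV[R]_d => poisson_formula Sigma SigmaP p.1 p.2)
         @ within (regular_pairs SigmaP) (nbhs (X, Y))).

Definition roots_vanishing (R : realType) (d : nat) (Sigma : {fset 'cV[R]_d})
    (Y : 'cV[R]_d) : {fset 'cV[R]_d} :=
  [fset a in Sigma | dot a Y == 0]%fset.

(* Main.v *)
(* Let W' be the stabilizer of Y0 in W. By Steinberg's theorem it is the Weyl group
   of the roots Sigma' vanishing at Y0. For |Y| = 1 the alternating sum in the
   Poisson formula is a sum over w of det w / (1 + |X|^2 - 2 <X, w Y>)^(d/2), and it
   splits into the terms with w in W' and the others. Both parts are alternating
   under W' in X and in Y, hence equal to pi'(X) pi'(Y) times a continuous function: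
   R1 on the product of balls for the first part, R2 near (Y0, Y0) for the second,
   whose denominators do not vanish there. This yields the continuous extension

     P(X, Y0) = (1 - |X|^2) (R1 + R2)(X, Y0) / (|W| w_d pi''(X) pi''(Y0)).

   R1(X, Y0) is exact: along Y = Y0 + t Z the denominators are
   (|X - Y0|^2 - 2 t <X, w Z>)^(d/2), and in the Taylor expansion in t only the power
   sums of the <X, w Z> weighted by det w enter. They vanish below the degree
   gamma', where the sum is gamma'! pi'(X) pi'(Z) / pi'(rho'/2) by the Weyl
   denominator formula. So R1(X, Y0) is a constant times |X - Y0|^-(2 gamma' + d),
   while R2 stays bounded. *)

Require Import Defs.
From HB Require Import structures.
From mathcomp Require Import all_boot all_order all_algebra finmap.
From mathcomp Require Import all_classical all_reals all_analysis.
From mathcomp Require Import measurable_realfun ring lra.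

Set Implicit Arguments.
Unset Strict Implicit.
Unset Printing Implicit Defensive.

Import Order.TTheory GRing.Theory Num.Theory.
Import numFieldNormedType.Exports.

Local Open Scope classical_set_scope.
Local Open Scope ring_scope.

(** * Reflections in Euclidean space *)

Section EuclideanSpace.
Variables (R : realType) (d : nat).
Implicit Types (a b u v x y : 'cV[R]_d) (w : 'M[R]_d).

(** The difficulty is that Y0 may lie on root hyperplanes, where the formula reads 0/0.
    [poisson_kernel] is a limit over regular pairs in both variables, so the quotients by pi'(X)
    pi'(Y) must be jointly continuous, for R1 up to the boundary of the second ball. They are
    obtained by dividing out one linear form at a time within a class of functions closed under this
    operation. Their domains have to be invariant under the projections onto the hyperplanes of
    Sigma', hence are balls centred on all of these: at 0 for R1, at Y0 for R2. Only the
    lowest-degree part of the Weyl denominator formula is needed. It is reached without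
    exponentials, by summing over all choices of signs of the positive roots: such a sum is an
    iterated central difference, and the half sums that survive are the W'-translates of rho'/2. In
    the constant, gamma'! cancels against the Taylor coefficient, which supplies one factor
    2^gamma'; the other comes from pi'(rho'/2) = 2^-gamma' pi'(rho'). Since 1/0 = 0 by convention,
    w_d must be shown to be nonzero, whence Gamma(d/2) > 0. *)

Lemma dot_mxE u v : dot u v = (u^T *m v) 0 0.
Proof. by rewrite mxE; apply: eq_bigr => i _; rewrite mxE. Qed.

Lemma dotC u v : dot u v = dot v u.
Proof. by apply: eq_bigr => i _; rewrite mulrC. Qed.

Lemma dotDl u v x : dot (u + v) x = dot u x + dot v x.
Proof. by rewrite /dot -big_split; apply: eq_bigr => i _; rewrite mxE mulrDl. Qed.

Lemma dotZl k u x : dot (k *: u) x = k * dot u x.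
Proof. by rewrite /dot mulr_sumr; apply: eq_bigr => i _; rewrite mxE mulrA. Qed.

Lemma dotNl u x : dot (- u) x = - dot u x.
Proof. by rewrite -scaleN1r dotZl mulN1r. Qed.

Lemma dotBl u v x : dot (u - v) x = dot u x - dot v x.
Proof. by rewrite dotDl dotNl. Qed.

Lemma dotDr u v x : dot x (u + v) = dot x u + dot x v.
Proof. by rewrite !(dotC x) dotDl. Qed.

Lemma dotZr k u x : dot x (k *: u) = k * dot x u.
Proof. by rewrite !(dotC x) dotZl. Qed.

Lemma dotNr u x : dot x (- u) = - dot x u.
Proof. by rewrite !(dotC x) dotNl. Qed.

Lemma dotBr u v x : dot x (u - v) = dot x u - dot x v.
Proof. by rewrite !(dotC x) dotBl. Qed.

Lemma dot0l x : dot 0 x = 0.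
Proof. by rewrite -(scale0r 0) dotZl mul0r. Qed.

Lemma dot0r x : dot x 0 = 0.
Proof. by rewrite dotC dot0l. Qed.

Lemma dot_suml (I : Type) (s : seq I) (P : pred I) (F : I -> 'cV[R]_d) x :
  dot (\sum_(i <- s | P i) F i) x = \sum_(i <- s | P i) dot (F i) x.
Proof.
elim/big_rec2: _ => [|i y1 y2 _ <-]; first exact: dot0l.
by rewrite dotDl.
Qed.

Lemma dot_ge0 u : 0 <= dot u u.
Proof. by apply: sumr_ge0 => i _; rewrite -expr2 sqr_ge0. Qed.

Lemma dot_eq0 u : (dot u u == 0) = (u == 0).
Proof.
apply/idP/eqP => [|->]; last by rewrite dot0l.
rewrite psumr_eq0 => [/allP u0|i _]; last by rewrite -expr2 sqr_ge0.
apply/matrixP => i j; rewrite !mxE ord1; apply/eqP.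
by have := u0 i (mem_index_enum i); rewrite -expr2 sqrf_eq0.
Qed.

Lemma dot_gt0 u : (0 < dot u u) = (u != 0).
Proof. by rewrite lt_neqAle dot_ge0 andbT eq_sym dot_eq0. Qed.

Lemma dot_mulmxr w u v : dot u (w *m v) = dot (w^T *m u) v.
Proof. by rewrite !dot_mxE trmx_mul trmxK mulmxA. Qed.

Lemma dot_orthogonal w u v : w^T *m w = 1%:M -> dot (w *m u) (w *m v) = dot u v.
Proof. by move=> ww; rewrite dot_mulmxr mulmxA ww mul1mx. Qed.

(** The difference of the two sides is <a, a> times the squared norm of the component of b
    orthogonal to a, which is nonzero. *)
Lemma cauchy_schwarz_strict a b :
  a != 0 -> (forall k, b != k *: a) -> dot a b ^+ 2 < dot a a * dot b b.
Proof.
move=> a0 nab; have aa : 0 < dot a a by rewrite dot_gt0.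
set k := dot a b / dot a a.
have : 0 < dot (b - k *: a) (b - k *: a) * dot a a.
  by rewrite mulr_gt0 // dot_gt0 subr_eq0.
suff -> : dot (b - k *: a) (b - k *: a) * dot a a = dot a a * dot b b - dot a b ^+ 2.
  by rewrite subr_gt0.
rewrite !(dotBl, dotBr, dotZl, dotZr) (dotC b a) /k; field.
by rewrite gt_eqF.
Qed.

Lemma reflectionE a x :
  reflection a *m x = x - (2 * dot a x / dot a a) *: a.
Proof.
rewrite /reflection mulmxBl mul1mx -scalemxAl -mulmxA; congr (_ - _).
have -> : a *m (a^T *m x) = dot a x *: a.
  by rewrite [a^T *m x]mx11_scalar -dot_mxE mul_mx_scalar.
by rewrite scalerA; congr (_ *: _); rewrite mulrAC.
Qed.

Lemma reflection_fix a x : dot a x = 0 -> reflection a *m x = x.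
Proof. by move=> ax; rewrite reflectionE ax mulr0 mul0r scale0r subr0. Qed.

Lemma reflection_self a : a != 0 -> reflection a *m a = - a.
Proof.
rewrite -dot_eq0 => a0; rewrite reflectionE mulfK // scaler_nat mulr2n.
by rewrite opprD addNKr.
Qed.

Lemma reflection_tr a : (reflection a)^T = reflection a.
Proof. by rewrite /reflection linearB linearZ /= trmx1 trmx_mul trmxK. Qed.

Lemma eq_mulmx_cV w1 w2 : (forall x, w1 *m x = w2 *m x) -> w1 = w2.
Proof.
move=> h; apply/matrixP => i j.
by have /matrixP/(_ i 0) := h (delta_mx j 0); rewrite -!colE !mxE.
Qed.

Lemma reflectionK a : a != 0 -> reflection a *m reflection a = 1%:M.
Proof.
move=> a0; apply: eq_mulmx_cV => x; rewrite mul1mx -mulmxA.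
rewrite [X in _ *m X]reflectionE mulmxBr -scalemxAr reflection_self //.
by rewrite reflectionE scalerN opprK subrK.
Qed.

(** Sylvester's determinant identity in rank one: [E] factors one block matrix in two ways into
    triangular ones. *)
Lemma det_1Bmulmx (u v : 'cV[R]_d) : \det (1%:M - u *m v^T) = 1 - dot v u.
Proof.
have E : block_mx 1%:M u 0 (1%:M : 'M[R]_1) *m block_mx (1%:M - u *m v^T) 0 v^T 1%:M
  = block_mx 1%:M 0 v^T 1%:M *m block_mx 1%:M u 0 (1%:M - v^T *m u).
  rewrite !mulmx_block !mul1mx !mulmx1 !mul0mx !addr0 !add0r.
  by rewrite subrK addrC subrK.
have := congr1 determinant E; rewrite !det_mulmx !det_ublock !det_lblock !det1.
by rewrite !mulr1 !mul1r => ->; rewrite det_mx11 !mxE dot_mxE !mxE eqxx.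
Qed.

Lemma det_reflection a : a != 0 -> \det (reflection a) = -1.
Proof.
move=> a0; rewrite /reflection scalemxAl det_1Bmulmx dotZr divfK ?dot_eq0 //.
by ring.
Qed.

End EuclideanSpace.

(** * Positive and simple roots *)

(* Unlike [root_system], the roots need not span, so that the roots vanishing at
   a point qualify. *)
Record root_subsystem (R : realType) (d : nat) (S : {fset 'cV[R]_d}) : Prop :=
  RootSubsystem {
    rsub_neq0 : forall a, a \in S -> a != 0;
    rsub_reflection : forall a b, a \in S -> b \in S -> reflection a *m b \in S;
    rsub_integral : forall a b,
      a \in S -> b \in S -> 2 * dot b a / dot a a \is a Num.int;
    rsub_reduced : forall a (c : R),
      a \in S -> c *: a \in S -> c = 1 \/ c = -1 }.

Lemma int_num_gt0 (R : realType) (x : R) : x \is a Num.int -> 0 < x ->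
  x = 1 \/ 2 <= x.
Proof.
move=> /intrP[z ->]; rewrite ltr0z => z0.
have [->|z1] := eqVneq z 1; first by left.
by right; rewrite (ler_int _ 2); case: z z0 z1 => [[|[|n]]|n].
Qed.

Section Roots.
Variables (R : realType) (d : nat) (S : {fset 'cV[R]_d}).
Hypothesis hS : root_subsystem S.
Implicit Types (a b g x : 'cV[R]_d) (w : 'M[R]_d).

Lemma rsub_opp a : a \in S -> - a \in S.
Proof.
move=> aS; have := rsub_reflection hS aS aS.
by rewrite reflection_self ?(rsub_neq0 hS).
Qed.

(** The Cartan integers of a and b are positive with product below 4 by strict Cauchy-Schwarz, so
    one of them is 1, and the corresponding reflection yields a - b or its opposite. *)
Lemma rsub_sub a b : a \in S -> b \in S -> a != b -> 0 < dot a b -> a - b \in S.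
Proof.
move=> aS bS ab dab.
have a0 := rsub_neq0 hS aS; have b0 := rsub_neq0 hS bS.
have aa : 0 < dot a a by rewrite dot_gt0.
have bb : 0 < dot b b by rewrite dot_gt0.
have np k : b != k *: a.
  apply/eqP => bk; have [k1|k1] : k = 1 \/ k = -1 by apply: (rsub_reduced hS aS);
    rewrite -bk.
  - by move: ab; rewrite bk k1 scale1r eqxx.
  - by move: dab; rewrite bk k1 dotZr mulN1r oppr_gt0 lt_gtF.
have cs := cauchy_schwarz_strict a0 np.
have m0 : 0 < 2 * dot b a / dot a a by rewrite divr_gt0 // mulr_gt0 // dotC.
have n0 : 0 < 2 * dot a b / dot b b by rewrite divr_gt0 // mulr_gt0.
have [m1|m2] := int_num_gt0 (rsub_integral hS aS bS) m0.
  rewrite -opprB; apply: rsub_opp; have := rsub_reflection hS aS bS.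
  by rewrite reflectionE (dotC a b) m1 scale1r.
have [n1|n2] := int_num_gt0 (rsub_integral hS bS aS) n0.
  have := rsub_reflection hS bS aS.
  by rewrite reflectionE (dotC b a) n1 scale1r.
have : 2 * dot a a * (2 * dot b b) <= (2 * dot b a) * (2 * dot a b).
  apply: ler_pM; rewrite ?mulr_ge0 ?dot_ge0 //.
  - by rewrite -ler_pdivlMr.
  - by rewrite -ler_pdivlMr.
rewrite (dotC b a) => h.
by have : False by nra.
Qed.

Section Positive.
Variable H : 'cV[R]_d.
Hypothesis Hreg : forall a, a \in S -> dot a H != 0.

Definition positive_root a := (a \in S) && (0 < dot a H).
Definition simple_root a :=
  positive_root a /\ forall b g, positive_root b -> positive_root g -> a <> b + g.

Lemma positive_oppP a : a \in S -> positive_root a \/ positive_root (- a).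
Proof.
move=> aS; have := Hreg aS; rewrite /positive_root aS rsub_opp // dotNl oppr_gt0.
by rewrite neq_lt => /orP[]; [right|left].
Qed.

Lemma positive_opp a : positive_root a -> ~~ positive_root (- a).
Proof.
by move=> /andP[_ a0]; rewrite /positive_root dotNl oppr_gt0 (lt_gtF a0) andbF.
Qed.

(** Induction on the height <a, H>, well founded because only finitely many roots lie below a given
    one: [n] counts them. *)
Lemma positive_ind (Q : 'cV[R]_d -> Prop) :
  (forall a, positive_root a ->
    (forall b, positive_root b -> dot b H < dot a H -> Q b) -> Q a) ->
  forall a, positive_root a -> Q a.
Proof.
move=> IH a; pose n a := #|` [fset b in S | 0 < dot b H < dot a H]%fset|.
have [m] := ubnP (n a); elim: m a => // m IHm a am pa; apply: (IH _ pa) => b pb ba.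
apply: (IHm b) => //; move: am; rewrite ltnS; apply: leq_trans.
apply: fproper_ltn_card; rewrite fproperE; apply/andP; split.
  by apply/fsubsetP => c; rewrite !inE => /and3P[-> -> /=] /lt_trans; exact.
apply/fsubsetPn; exists b; rewrite !inE ?ltxx ?andbF // ba andbT.
by case/andP: pb => -> ->.
Qed.

Lemma simple_ind (Q : 'cV[R]_d -> Prop) :
  (forall a, simple_root a -> Q a) ->
  (forall a b, positive_root a -> positive_root b -> Q a -> Q b -> Q (a + b)) ->
  forall a, positive_root a -> Q a.
Proof.
move=> Qs Qa; apply: positive_ind => a pa IH.
have [sa|] := pselect (simple_root a); first exact: Qs.
move=> /not_andP[//|/existsNP[b /existsNP[g /not_implyP[pb /not_implyP[pg]]]]].
move=> /contrapT ag; have [_ b0] := andP pb; have [_ g0] := andP pg.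
by rewrite ag; apply: Qa => //; apply: IH => //;
  rewrite ag dotDl ?ltrDl ?ltrDr.
Qed.

(** Stands in for the uniqueness of coordinates in the simple roots. One of b and g, say b, has
    positive product with a, so b - a is a root. It is positive because a is indecomposable, and (b
    - a) + g is the next smaller multiple of a. *)
Lemma simple_multiple (n : nat) a b g : simple_root a -> positive_root b -> positive_root g ->
  b != a -> g != a -> b + g <> n%:R *: a.
Proof.
move=> sa; have [aS a0] := andP sa.1.
elim: n b g => [|n IHn] b g pb pg ba ga e.
  have [_ b0] := andP pb; have [_ g0] := andP pg.
  have : dot (b + g) H = 0 by rewrite e mulr0n scale0r dot0l.
  by rewrite dotDl => h; move: (addr_gt0 b0 g0); rewrite h ltxx.
wlog dba : b g pb pg ba ga e / 0 < dot b a.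
  move=> wl; have [|bNa] := ltP 0 (dot b a); first exact: (wl b g).
  apply: (wl g b) => //; first by rewrite addrC.
  have : 0 < dot (b + g) a.
    by rewrite e dotZl mulr_gt0 ?ltr0n // dot_gt0 (rsub_neq0 hS).
  by rewrite dotDl => h; lra.
have [bS b0] := andP pb; have [gS g0] := andP pg.
have baS := rsub_sub bS aS ba dba.
have [pba|pab] := positive_oppP baS; last first.
  by apply: (sa.2 b (- (b - a))) => //; rewrite opprB addrC subrK.
apply: (IHn (b - a) g) => //.
  (* Here b - a = a would make 2a a root. *)
  apply/eqP => /(canRL (subrK _)) e2.
  have := rsub_reduced hS (c := 2) aS; rewrite scaler_nat mulr2n -e2.
  by move=> /(_ bS) [] h2; lra.
by rewrite addrAC e -natr1 scalerDl scale1r addrK.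
Qed.

(** The difference of b and its reflection is an integer multiple m a. If the reflected root were
    negative, m would be a positive integer and m a the sum of two positive roots other than a. *)
Lemma reflection_simple a b : simple_root a -> positive_root b -> b != a ->
  positive_root (reflection a *m b).
Proof.
move=> sa pb ba; have [aS a0] := andP sa.1; have [bS b0] := andP pb.
have [//|pN] := positive_oppP (rsub_reflection hS aS bS).
have := rsub_integral hS aS bS.
set m := (X in X \is a Num.int) => mi.
have e : b - reflection a *m b = m *: a.
  by rewrite reflectionE opprB addrC subrK (dotC a b).
have m0 : 0 < m.
  have : 0 < dot (m *: a) H.
    by rewrite -e dotDl addr_gt0 //; case/andP: pN.
  by rewrite dotZl pmulr_lgt0.
move: mi; rewrite intrEge0 ?ltW // => /natrP[n mn].
exfalso; apply: (simple_multiple (n := n) sa pb pN ba); last by rewrite e mn.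
apply/eqP => /(canRL opprK) ra.
have : reflection a *m (reflection a *m b) = a.
  by rewrite ra mulmxN reflection_self ?opprK // (rsub_neq0 hS).
by rewrite mulmxA reflectionK ?mul1mx ?(rsub_neq0 hS) // => /eqP; rewrite (negPf ba).
Qed.

(** Otherwise b would have nonpositive product with all simple roots, hence with all positive ones,
    b included. *)
Lemma simple_dot_gt0 b : positive_root b ->
  exists2 a, simple_root a & 0 < dot b a.
Proof.
move=> pb; apply: contrapT => h; have [bS _] := andP pb.
have : 0 < dot b b by rewrite dot_gt0 (rsub_neq0 hS).
apply/negP; rewrite -leNgt.
apply: (simple_ind (Q := fun x => dot b x <= 0)) pb => [a sa|x y _ _ xb yb].
- by rewrite leNgt; apply/negP => ab; apply: h; exists a.
- by rewrite dotDr; lra.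
Qed.

End Positive.
End Roots.

(** * Weyl groups *)

Lemma seq_argmax (T : eqType) (R : realType) (f : T -> R) (s : seq T) x :
  x \in s -> exists2 y, y \in s & forall z, z \in s -> f z <= f y.
Proof.
elim: s x => // a [|b s] IHs x _.
  by exists a; rewrite ?mem_seq1 // => z; rewrite mem_seq1 => /eqP ->.
have [y ys ym] := IHs b (mem_head _ _).
have [fya|fay] := leP (f y) (f a).
  exists a; rewrite ?mem_head // => z; rewrite (in_cons a) => /orP[/eqP -> //|/ym].
  by move=> /le_trans; exact.
exists y; rewrite ?(in_cons a) ?ys ?orbT // => z;
  rewrite (in_cons a) => /orP[/eqP ->|/ym //].
exact: ltW.
Qed.

Section WeylGroup.
Variables (R : realType) (d : nat) (S : {fset 'cV[R]_d}).
Hypothesis hS : root_subsystem S.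
Implicit Types (a b g x : 'cV[R]_d) (w : 'M[R]_d).
Local Notation W := (weyl_group S).
Local Notation word s := (\big[mulmx/1%:M]_(a <- s) reflection a).

Lemma word_cat (s1 s2 : seq 'cV[R]_d) : word (s1 ++ s2) = word s1 *m word s2.
Proof.
by elim: s1 => [|a s1 IHs]; rewrite ?big_nil ?mul1mx // !big_cons IHs mulmxA.
Qed.

Lemma word1 a : word [:: a] = reflection a.
Proof. by rewrite big_cons big_nil mulmx1. Qed.

Lemma weyl1 : W 1%:M.
Proof. by exists [::] => //; rewrite big_nil. Qed.

Lemma weylM w1 w2 : W w1 -> W w2 -> W (w1 *m w2).
Proof.
move=> [s1 h1 ->] [s2 h2 ->]; exists (s1 ++ s2); last by rewrite word_cat.
by move=> a; rewrite mem_cat => /orP[/h1|/h2].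
Qed.

Lemma weyl_reflection a : a \in S -> W (reflection a).
Proof.
move=> aS; exists [:: a]; last by rewrite word1.
by move=> b; rewrite mem_seq1 => /eqP ->.
Qed.

Lemma weyl_ind (Q : 'M[R]_d -> Prop) : Q 1%:M ->
  (forall a w, a \in S -> W w -> Q w -> Q (reflection a *m w)) ->
  forall w, W w -> Q w.
Proof.
move=> Q1 QM w [s sS ->]; elim: s sS => [|a s IHs] sS; first by rewrite big_nil.
have sS' : {subset s <= S} by move=> b bs; apply: sS; rewrite inE bs orbT.
rewrite big_cons; apply: QM; [exact/sS/mem_head|by exists s|exact: IHs].
Qed.

Lemma weyl_tr_mul w : W w -> w^T *m w = 1%:M.
Proof.
elim/weyl_ind => [|a {}w aS _ IH]; first by rewrite trmx1 mul1mx.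
rewrite trmx_mul reflection_tr mulmxA -(mulmxA w^T) reflectionK ?mulmx1 //.
exact: rsub_neq0 aS.
Qed.

Lemma weyl_mul_tr w : W w -> w *m w^T = 1%:M.
Proof. by move=> /weyl_tr_mul /mulmx1C. Qed.

Lemma weyl_tr w : W w -> W w^T.
Proof.
elim/weyl_ind => [|a {}w aS _ IH]; first by rewrite trmx1; exact: weyl1.
by rewrite trmx_mul reflection_tr; apply: weylM => //; exact: weyl_reflection.
Qed.

Lemma weyl_root w a : W w -> a \in S -> w *m a \in S.
Proof.
move=> Ww aS; elim/weyl_ind: Ww => [|b {}w bS _ IH]; first by rewrite mul1mx.
by rewrite -mulmxA; apply: rsub_reflection.
Qed.

Lemma weyl_dot w x y : W w -> dot (w *m x) (w *m y) = dot x y.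
Proof. by move=> Ww; rewrite dot_orthogonal // weyl_tr_mul. Qed.

Lemma reflection_conj w a : W w -> reflection (w *m a) *m w = w *m reflection a.
Proof.
move=> Ww; apply: eq_mulmx_cV => x; rewrite -!mulmxA !reflectionE mulmxBr.
by rewrite !weyl_dot // -scalemxAr.
Qed.

(** Since the roots span, w is determined by the map [f w] it induces on them. The choice [g] of an
    element inducing a given map sends a finite set onto a superset of W. *)
Lemma weyl_finite :
  (forall X : 'cV[R]_d, exists c : 'cV[R]_d -> R, X = \sum_(a <- S) c a *: a) ->
  finite_set W.
Proof.
move=> span.
pose f w : {ffun S -> S} := [ffun a => insubd a (w *m val a)].
pose g (phi : {ffun S -> S}) := xget 0 [set w | W w /\ f w = phi].
apply: (@sub_finite_set _ _ (g @` setT)); last exact/finite_image/finite_finset.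
move=> w Ww; exists (f w) => //; rewrite /g.
have [Ww' fw] : W (g (f w)) /\ f (g (f w)) = f w.
  by rewrite /g; apply: (@xgetPex _ 0 [set w' | W w' /\ f w' = f w]); exists w.
move: Ww' fw; rewrite -/(g (f w)); move: (g (f w)) => w' Ww' fw.
apply: eq_mulmx_cV => X; have [c ->] := span X.
rewrite !mulmx_sumr; apply: eq_big_seq => a aS; rewrite -!scalemxAr; congr (_ *: _).
have := congr1 (fun phi : {ffun S -> S} => val (phi [` aS]%fset)) fw.
by rewrite /= !ffunE !val_insubd /= !weyl_root.
Qed.

(** Transitivity on chambers. Take u maximizing <u H1, H2>: composing with the reflection in u a
    does not increase this value, which says that <a, H1> <u a, H2> >= 0. *)
Lemma weyl_transitive (H1 H2 : 'cV[R]_d) : finite_set W ->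
  (forall a, a \in S -> dot a H1 != 0) -> (forall a, a \in S -> dot a H2 != 0) ->
  exists2 u, W u & forall a, a \in S -> (0 < dot (u *m a) H2) = (0 < dot a H1).
Proof.
move=> Wfin r1 r2.
have W1 : 1%:M \in fset_set W by rewrite in_fset_set // inE; exact: weyl1.
have [u uW um] := seq_argmax (fun w => dot (w *m H1) H2) W1.
have Wu : W u by move: uW; rewrite in_fset_set // inE.
exists u => // a aS; have uaS := weyl_root Wu aS.
have /um : reflection (u *m a) *m u \in fset_set W.
  by rewrite in_fset_set // inE; exact/weylM/Wu/weyl_reflection.
rewrite -mulmxA reflectionE !weyl_dot // dotBl dotZl gerBl => h.
have n1 := r1 _ aS; have n2 := r2 _ uaS.
have aa : 0 < dot a a by rewrite dot_gt0 (rsub_neq0 hS).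
have {}h : 0 < dot a H1 * dot (u *m a) H2.
  rewrite lt_neqAle eq_sym mulf_neq0 //=.
  move: h; rewrite mulrAC pmulr_lge0 ?invr_gt0 // -mulrA pmulr_rge0 //.
move: n1; rewrite neq_lt => /orP[n1|n1].
  by rewrite (lt_gtF n1); move: h; rewrite nmulr_rgt0 // => /lt_gtF.
by rewrite n1; move: h; rewrite pmulr_rgt0.
Qed.

(** * Words in simple reflections *)

Section Chamber.
Variable H : 'cV[R]_d.
Hypothesis Hreg : forall a, a \in S -> dot a H != 0.
Local Notation positive_root := (positive_root S H).
Local Notation simple_root := (simple_root S H).

Definition simple_word (s : seq 'cV[R]_d) := forall a, a \in s -> simple_root a.

Lemma simple_word_cat s1 s2 : simple_word (s1 ++ s2) <-> simple_word s1 /\ simple_word s2.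
Proof.
split=> [h|[h1 h2] a]; last by rewrite mem_cat => /orP[/h1|/h2].
by split=> a as_; apply: h; rewrite mem_cat as_ ?orbT.
Qed.

Lemma simple_word_weyl s : simple_word s -> W (word s).
Proof. by move=> ss; exists s => // a /ss[/andP[]]. Qed.

(** If b is not simple, choose a simple a with <b, a> > 0. The reflection in b is then conjugate
    under that in a to the reflection in a positive root of smaller height. *)
Lemma reflection_simple_word a : positive_root a ->
  exists2 s, simple_word s & reflection a = word s.
Proof.
move: a; apply: positive_ind => b pb IH.
have [sb|nsb] := pselect (simple_root b).
  by exists [:: b]; rewrite ?word1 // => a; rewrite mem_seq1 => /eqP ->.
have [a sa ab] := simple_dot_gt0 hS pb.
have [aS a0] := andP sa.1; have [bS b0] := andP pb.
have ba : b != a by apply/eqP => e; rewrite e in nsb.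
have pab := reflection_simple hS Hreg sa pb ba.
have [|s ss e] := IH _ pab.
  rewrite reflectionE dotBl dotZl gtrBl !mulr_gt0 ?invr_gt0 ?dot_gt0 ?(rsub_neq0 hS) //.
  by rewrite dotC.
exists (a :: s ++ [:: a]).
  by move=> c; rewrite inE mem_cat mem_seq1 => /or3P[/eqP ->|/ss|/eqP ->].
rewrite big_cons word_cat word1 /= -e.
rewrite reflection_conj ?mulmxA ?reflectionK ?mul1mx ?(rsub_neq0 hS) //.
exact: weyl_reflection.
Qed.

Lemma weyl_simple_word w : W w -> exists2 s, simple_word s & w = word s.
Proof.
elim/weyl_ind => [|a {}w aS _ [s ss ->]]; first by exists [::]; rewrite ?big_nil.
have [t st ->] : exists2 t, simple_word t & reflection a = word t.
  have [pa|pa] := positive_oppP hS Hreg aS; first exact: reflection_simple_word.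
  have [t st e] := reflection_simple_word pa; exists t => //; rewrite -e.
  apply: eq_mulmx_cV => x; rewrite !reflectionE !(dotNl, dotNr, opprK) scalerN.
  by rewrite mulrN mulNr scaleNr opprK.
by exists (t ++ s); [exact/simple_word_cat|rewrite word_cat].
Qed.

(** Some letter turns the image of b from positive to negative. A simple reflection keeps every
    positive root but its own positive, so this image is the letter itself. *)
Lemma simple_word_exchange s b : simple_word s -> positive_root b ->
  positive_root (- (word s *m b)) ->
  exists s1 a s2, s = s1 ++ a :: s2 /\ word s2 *m b = a.
Proof.
move=> + pb; elim: s => [|a s IHs] ss.
  by rewrite big_nil mul1mx (negPf (positive_opp pb)).
have ss' : simple_word s by move=> c cs; apply: ss; rewrite inE cs orbT.
have sa : simple_root a by apply/ss/mem_head.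
rewrite big_cons -mulmxA => h.
have [bS _] := andP pb.
have [p|p] := positive_oppP hS Hreg (weyl_root (simple_word_weyl ss') bS).
  exists [::], a, s; split=> //; apply/eqP; apply: contraLR h => ne.
  exact/positive_opp/reflection_simple.
have [s1 [c [s2 [-> e]]]] := IHs ss' p.
by exists (a :: s1), c, s2.
Qed.

(* A word in simple reflections preserving the positive roots sends its last
   letter to a negative root before the final reflection, so the exchange
   property shortens it by two letters. *)
Lemma weyl_free w : W w -> (forall a, positive_root a -> positive_root (w *m a)) -> w = 1%:M.
Proof.
move=> /weyl_simple_word[s + ->]; have [n] := ubnP (size s).
elim: n s => // n IHn s; case/lastP: s => [|s a]; first by rewrite big_nil.
rewrite size_rcons ltnS -cats1 => sn /simple_word_cat[ss sa] pw.
have {}sa : simple_root a by apply: sa; rewrite mem_head.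
have [aS a0] := andP sa.1; have an0 := rsub_neq0 hS aS.
have [|s1 [b [s2 [es eb]]]] := simple_word_exchange ss sa.1.
  have := pw _ sa.1; rewrite word_cat word1 /= -mulmxA reflection_self //.
  by rewrite mulmxN.
have [ss1 ss2] := (simple_word_cat _ _).1 (eq_ind s simple_word ss _ es).
have {}ss2 : simple_word s2 by move=> c cs; apply: ss2; rewrite inE cs orbT.
have e : word (s ++ [:: a]) = word (s1 ++ s2).
  rewrite es !word_cat big_cons word1 /= -!mulmxA; congr (_ *m _).
  rewrite -eb mulmxA reflection_conj; last exact: simple_word_weyl.
  by rewrite -mulmxA reflectionK // mulmx1.
rewrite e; apply: IHn.
- move: sn; rewrite es !size_cat /= addnS; apply: leq_trans.
  by rewrite ltnS.
- exact/simple_word_cat.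
- by rewrite -e.
Qed.

End Chamber.
End WeylGroup.

(** * Products and half sums of positive roots *)

Lemma perm_map_sub (T1 T2 : eqType) (f : T1 -> T2) (s : seq T1) (t : seq T2) :
  uniq s -> {in s &, injective f} -> {in s, forall x, f x \in t} ->
  (size t <= size s)%N -> uniq t -> perm_eq (map f s) t.
Proof.
move=> us fi fst ts ut.
have ufs : uniq (map f s) by rewrite map_inj_in_uniq.
have sub : {subset map f s <= t} by move=> y /mapP[x xs ->]; exact: fst.
have [|_ e] := uniq_min_size ufs sub; first by rewrite size_map.
exact: uniq_perm.
Qed.

Lemma map_uniq_inj (T1 T2 : eqType) (f : T1 -> T2) (s : seq T1) :
  uniq (map f s) -> {in s &, injective f}.
Proof.
move=> ufs x y xs ys fxy; rewrite -(nth_index x xs) -(nth_index x ys).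
congr (nth x s _); apply/eqP.
rewrite -(nth_uniq (f x) _ _ ufs) ?size_map ?index_mem //.
by rewrite !(nth_map x) ?index_mem // !nth_index ?fxy.
Qed.

Section PositiveRoots.
Variables (R : realType) (d : nat) (S : {fset 'cV[R]_d}) (H : 'cV[R]_d).
Hypothesis hS : root_subsystem S.
Hypothesis Hreg : forall a, a \in S -> dot a H != 0.
Implicit Types (a b x X Z : 'cV[R]_d) (w : 'M[R]_d) (c : seq 'cV[R]_d).
Local Notation W := (weyl_group S).
Local Notation P := [fset a in S | 0 < dot a H]%fset.

Lemma mem_positive a : (a \in P) = positive_root S H a.
Proof. by rewrite !inE. Qed.

Lemma perm_reflection_simple a : simple_root S H a ->
  perm_eq [seq reflection a *m b | b <- (P `\ a)%fset] (P `\ a)%fset.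
Proof.
move=> sa; have [aS a0] := andP sa.1; have an0 := rsub_neq0 hS aS.
apply: perm_map_sub => //; rewrite ?fset_uniq //.
- move=> b b' _ _ /(congr1 (mulmx (reflection a))).
  by rewrite !mulmxA reflectionK // !mul1mx.
- move=> b; rewrite in_fsetD1 mem_positive => /andP[ba pb].
  have := reflection_simple hS Hreg sa pb ba.
  rewrite in_fsetD1 mem_positive => ->; rewrite andbT.
  apply: contraTneq pb => e; rewrite -(mul1mx b) -(reflectionK an0) -mulmxA e.
  by rewrite reflection_self // (positive_opp sa.1).
Qed.

Lemma root_prod_simple a X : simple_root S H a ->
  root_prod P (reflection a *m X) = - root_prod P X.
Proof.
move=> sa; have aP : a \in P by rewrite mem_positive; exact: sa.1.
have an0 : a != 0 by apply: (rsub_neq0 hS); case/andP: sa.1.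
have E b : dot b (reflection a *m X) = dot (reflection a *m b) X.
  by rewrite dot_mulmxr reflection_tr.
rewrite /root_prod (big_fsetD1 a) //= [in RHS](big_fsetD1 a) //=.
rewrite E reflection_self // dotNl mulNr; congr (- (_ * _)).
rewrite -[RHS](perm_big _ (perm_reflection_simple sa)) big_map.
by apply: eq_bigr => b _; rewrite E.
Qed.

Lemma root_prod_weyl w X : W w -> root_prod P (w *m X) = \det w * root_prod P X.
Proof.
move=> /(weyl_simple_word hS Hreg)[s ss ->]; elim: s ss => [|a s IHs] ss.
  by rewrite big_nil mul1mx det1 mul1r.
have sa : simple_root S H a by apply/ss/mem_head.
rewrite big_cons -mulmxA root_prod_simple // IHs => [|b bs]; last first.
  by apply: ss; rewrite inE bs orbT.
rewrite det_mulmx det_reflection ?mulN1r ?mulNr //.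
by apply: (rsub_neq0 hS); case/andP: sa.1.
Qed.

(** The positive roots other than a are permuted by the reflection in a, so their sum is orthogonal
    to a. *)
Lemma dot_sum_positive_simple a : simple_root S H a ->
  dot (\sum_(b <- P) b) a = dot a a.
Proof.
move=> sa; have aP : a \in P by rewrite mem_positive; exact: sa.1.
have an0 : a != 0 by apply: (rsub_neq0 hS); case/andP: sa.1.
rewrite (big_fsetD1 a) //= dotDl.
set D := \sum_(_ <- _) _; suff : dot D a = - dot D a by move=> h; lra.
rewrite {1}/D -(perm_big _ (perm_reflection_simple sa)) big_map dot_suml.
rewrite -dotNr -(reflection_self an0) dot_suml.
by apply: eq_bigr => b _; rewrite dot_mulmxr reflection_tr.
Qed.

End PositiveRoots.

(** * Sign choices and central differences *)

Section SignChoices.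
Variables (R : realType) (d : nat).
Implicit Types (a b x X Z : 'cV[R]_d) (s c : seq 'cV[R]_d).

(** These index the terms in the expansion of the Weyl denominator, the product of the e^(a/2) -
    e^(-a/2): the exponents are the half sums, and the sign of a term is carried by the product of
    the values <a, X>. *)
Fixpoint sign_choices s : seq (seq 'cV[R]_d) :=
  if s is a :: s' then
    [seq a :: c | c <- sign_choices s'] ++ [seq - a :: c | c <- sign_choices s']
  else [:: [::]].

Definition half_sum c : 'cV[R]_d := 2^-1 *: \sum_(a <- c) a.

Lemma sum_sign_choices_cons a s (F : seq 'cV[R]_d -> R) :
  \sum_(c <- sign_choices (a :: s)) F c =
  \sum_(c <- sign_choices s) (F (a :: c) + F (- a :: c)).
Proof. by rewrite /= big_cat !big_map big_split. Qed.

Lemma sign_choices_mem s c : c \in sign_choices s ->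
  [/\ forall a, a \in c -> a \in s \/ - a \in s,
      forall a, a \in s -> a \in c \/ - a \in c & size c = size s].
Proof.
elim: s c => [|a s IHs] c /=; first by rewrite mem_seq1 => /eqP ->.
rewrite mem_cat => /orP[] /mapP[c' /IHs[h1 h2 h3] ->]; split=> [b|b|];
  rewrite ?inE /= ?h3 //.
- by move=> /predU1P[->|/h1[]]; rewrite ?eqxx; [left|left; apply/orP; right|
    right; apply/orP; right].
- by move=> /predU1P[->|/h2[]]; rewrite ?eqxx; [left|left; apply/orP; right|
    right; apply/orP; right].
- by move=> /predU1P[->|/h1[]]; rewrite ?opprK ?eqxx; [right|left; apply/orP; right|
    right; apply/orP; right].
- by move=> /predU1P[->|/h2[]]; rewrite ?eqr_opp ?eqxx; [right|left; apply/orP; right|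
    right; apply/orP; right].
Qed.

Lemma sign_choices_map (H : 'cV[R]_d) s c : (forall a, a \in s -> 0 < dot a H) ->
  c \in sign_choices s -> [seq if 0 < dot a H then a else - a | a <- c] = s.
Proof.
elim: s c => [|a s IHs] c sH /=; first by rewrite mem_seq1 => /eqP ->.
have aH := sH a (mem_head _ _).
have sH' b : b \in s -> 0 < dot b H by move=> bs; apply: sH; rewrite inE bs orbT.
rewrite mem_cat => /orP[] /mapP[c' /(IHs _ sH') e ->] /=; rewrite e ?aH //.
by rewrite dotNl oppr_gt0 (lt_gtF aH) opprK.
Qed.

Lemma sign_choices_uniq (H : 'cV[R]_d) s c : uniq s ->
  (forall a, a \in s -> 0 < dot a H) -> c \in sign_choices s ->
  uniq c /\ forall a, a \in c -> - a \notin c.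
Proof.
move=> us sH cs; have e := sign_choices_map sH cs.
pose f a : 'cV[R]_d := if 0 < dot a H then a else - a.
have uf : uniq [seq f a | a <- c] by rewrite e.
have uc := map_uniq uf; split=> // a ac; apply/negP => nac.
have fi : {in c &, injective f} by exact: map_uniq_inj uf.
have [h _ _] := sign_choices_mem cs.
have a0 : dot a H != 0.
  have [/sH|/sH] := h a ac; first by move/gt_eqF => ->.
  by rewrite dotNl oppr_gt0 => /lt_eqF ->.
have : f a = f (- a).
  rewrite /f dotNl oppr_gt0 opprK; move: a0; rewrite neq_lt => /orP[] a0.
    by rewrite a0 (lt_gtF a0).
  by rewrite a0 (lt_gtF a0).
move=> /(fi _ _ ac nac) ea; move: a0;
  have : dot a H = - dot a H by rewrite -dotNl -ea.
by move=> e0; rewrite (_ : dot a H = 0) ?eqxx //; lra.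
Qed.

(** For each a in s exactly one of a and -a satisfies B, so exactly one sign choice lies entirely in
    B. *)
Lemma sum_sign_choices_all (B : pred 'cV[R]_d) s :
  (forall a, a \in s -> B a = ~~ B (- a)) ->
  \sum_(c <- sign_choices s) (all B c)%:R = 1 :> R.
Proof.
elim: s => [|a s IHs] sB; first by rewrite big_seq1.
rewrite sum_sign_choices_cons -[RHS]IHs => [|b bs]; last first.
  by apply: sB; rewrite inE bs orbT.
apply: eq_bigr => c _ /=; rewrite (sB a) ?mem_head //.
by case: (B (- a)); rewrite /= ?add0r ?addr0.
Qed.

(** The products over c and over s differ by a sign that does not depend on the vector. *)
Lemma sign_choices_prod s c X Y : c \in sign_choices s ->
  (\prod_(a <- c) dot a X) * (\prod_(a <- s) dot a Y) =
  (\prod_(a <- c) dot a Y) * (\prod_(a <- s) dot a X).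
Proof.
elim: s c => [|a s IHs] c; first by rewrite /= mem_seq1 => /eqP ->; rewrite !big_nil.
rewrite /= mem_cat => /orP[] /mapP[c' /IHs e ->]; rewrite !big_cons ?dotNl.
  by rewrite mulrACA e; ring.
by rewrite mulrACA e; ring.
Qed.

(** Up to the product of the <a, X>, the left side is the iterated central difference of x^n at 0
    with steps <a, Z>. It kills all degrees below the number of steps. *)
Lemma polarization s X Z n : (n <= size s)%N ->
  \sum_(c <- sign_choices s) (\prod_(a <- c) dot a X) * dot (half_sum c) Z ^+ n =
  if n == size s then n`!%:R * (\prod_(a <- s) dot a Z) * (\prod_(a <- s) dot a X)
  else 0.
Proof.
elim: s n => [|a s IHs] n.
  rewrite leqn0 => /eqP ->; rewrite big_seq1 !big_nil /= expr0 fact0; ring.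
move=> ns; rewrite sum_sign_choices_cons.
set h := 2^-1 * dot a Z.
transitivity (\sum_(i < n.+1) (dot a X * h ^+ i * (1 - (-1) ^+ i) *+ 'C(n, i)) *
  \sum_(c <- sign_choices s) (\prod_(a <- c) dot a X) * dot (half_sum c) Z ^+ (n - i)).
  under [RHS]eq_bigr => i _ do rewrite mulr_sumr.
  rewrite exchange_big /=; apply: eq_bigr => c _.
  have e b : dot (half_sum (b :: c)) Z = dot (half_sum c) Z + 2^-1 * dot b Z.
    by rewrite /half_sum big_cons scalerDr dotDl [in RHS]addrC !dotZl.
  rewrite !e !big_cons !dotNl mulrN -/h !exprDn !mulr_sumr -big_split.
  apply: eq_bigr => i _ /=; rewrite (exprNn h).
  rewrite !mulrnAr mulrnAl -mulrnDl; congr (_ *+ _).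
  move: (_ ^+ (n - i)) (h ^+ i) ((-1) ^+ i) (\prod_(_ <- _) _) => *.
  ring.
case: n ns => [_|n].
  by rewrite big_ord1 expr0 subrr mulr0 mul0rn mul0r.
rewrite ltnS => ns; rewrite big_ord_recl expr0 subrr mulr0 mul0rn mul0r add0r.
(* Two or more factors [h] leave a degree below the length of s, so only the term linear in [h]
   remains. *)
rewrite big_ord_recl /= [X in _ + X]big1 ?addr0 => [|i _]; last first.
  have lt : (n - i.+1 < size s)%N.
    by rewrite (leq_trans _ ns) // ltn_subrL /= (leq_trans (ltn0Sn i) (ltn_ord i)).
  rewrite (_ : (n.+1 - _ = n - i.+1)%N) // IHs ?(ltnW lt) //.
  by rewrite (ltn_eqF lt) mulr0.
rewrite /bump /= addn0 subSS subn0 IHs // eqSS; case: eqP => [e|_];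
  last by rewrite mulr0.
rewrite expr1 factS natrM !big_cons /h bin1 -[X in X * _ = _]mulr_natr; by field.
Qed.

End SignChoices.

(** * Half sums of signed positive roots *)

Section HalfSums.
Variables (R : realType) (d : nat) (S : {fset 'cV[R]_d}) (H : 'cV[R]_d).
Hypothesis hS : root_subsystem S.
Hypothesis Hreg : forall a, a \in S -> dot a H != 0.
Hypothesis Wfin : finite_set (weyl_group S).
Implicit Types (a b x X Z : 'cV[R]_d) (w : 'M[R]_d) (c : seq 'cV[R]_d).
Local Notation W := (weyl_group S).
Local Notation P := [fset a in S | 0 < dot a H]%fset.

Let posP a : a \in P -> 0 < dot a H.
Proof. by rewrite !inE => /andP[]. Qed.

Let PS a : a \in P -> a \in S.
Proof. by rewrite !inE => /andP[]. Qed.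

Lemma sign_choices_sub c a : c \in sign_choices P -> a \in c -> a \in S.
Proof.
move=> /sign_choices_mem[h _ _] /h[/PS //|/PS /(rsub_opp hS)].
by rewrite opprK.
Qed.

Lemma sign_choices_total c a : c \in sign_choices P -> a \in S ->
  a \in c \/ - a \in c.
Proof.
move=> /sign_choices_mem[_ h _] aS.
have [pa|pa] := positive_oppP hS Hreg aS.
  by apply: h; rewrite !inE; case/andP: pa => -> ->.
by have [] := h (- a); rewrite ?inE ?opprK; [exact: pa|right|left].
Qed.

(* If lambda = half_sum c is regular, it differs from the half sum of its own
   positive roots by a sum D of such roots; integrality makes D antidominant,
   so that |D|^2 <= 0. *)
Lemma half_sum_regular c : c \in sign_choices P ->
  (forall a, a \in S -> dot a (half_sum c) != 0) ->
  forall a, a \in c -> 0 < dot a (half_sum c).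
Proof.
set l := half_sum c => cP lreg.
have [uc cN] := sign_choices_uniq (fset_uniq P) posP cP.
pose Pl := [fset a in S | 0 < dot a l]%fset.
pose D := \sum_(a <- c | dot a l < 0) - a.
have Dsum : \sum_(a <- Pl) a = 2 *: (l + D).
  pose f a : 'cV[R]_d := if 0 < dot a l then a else - a.
  have fc : perm_eq [seq f a | a <- c] Pl.
    apply: uniq_perm; rewrite ?fset_uniq //.
      rewrite map_inj_in_uniq // => a b ac bc; rewrite /f.
      case: ifP => _; case: ifP => _ //.
      - by move=> e; move: (cN b bc); rewrite -e ac.
      - by move=> e; move: (cN a ac); rewrite e bc.
      - exact: oppr_inj.
    move=> b; apply/mapP/idP => [[a ac ->]|].
      have aS := sign_choices_sub cP ac.
      rewrite /f; case: ifP => a0; rewrite !inE ?aS ?rsub_opp //=.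
      by rewrite dotNl oppr_gt0 lt_neqAle lreg //= leNgt a0.
    rewrite !inE => /andP[bS b0]; have [bc|bc] := sign_choices_total cP bS.
      by exists b; rewrite // /f b0.
    by exists (- b); rewrite // /f dotNl oppr_gt0 (lt_gtF b0) opprK.
  rewrite -(perm_big _ fc) big_map scalerDr /l /half_sum scalerA mulfV // scale1r.
  rewrite /D (big_mkcond (fun a => dot a l < 0)) /= scaler_sumr -big_split /=.
  apply: eq_big_seq => a ac; rewrite /f.
  have := lreg a (sign_choices_sub cP ac); rewrite neq_lt => /orP[] a0.
    by rewrite a0 (lt_gtF a0) scalerN scaler_nat mulr2n opprD addrC subrK.
  by rewrite a0 (lt_gtF a0) scaler0 addr0.
(* For a simple on the chamber of l, 2 <l + D, a> = |a|^2. Thus 1 - 2 <D, a> / |a|^2 = 2 <l, a> /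
   |a|^2 is a positive integer, hence at least 1. *)
have Dsimple a : simple_root S l a -> dot D a <= 0.
  move=> sa; have [aS a0] := andP sa.1.
  have aa : 0 < dot a a by rewrite dot_gt0 (rsub_neq0 hS).
  have := dot_sum_positive_simple hS lreg sa; rewrite -/Pl Dsum dotZl dotDl => e.
  have Di : 2 * dot D a / dot a a \is a Num.int.
    rewrite /D dot_suml mulr_sumr mulr_suml big_seq_cond; apply: rpred_sum => b.
    move=> /andP[bc _]; apply: (rsub_integral hS aS).
    exact/(rsub_opp hS)/(sign_choices_sub cP).
  have li : 1 - 2 * dot D a / dot a a = 2 * dot l a / dot a a.
    rewrite -{1}(mulfV (lt0r_neq0 aa)) -mulrBl; congr (_ / _).
    by rewrite -e; ring.
  have : 0 < 1 - 2 * dot D a / dot a a.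
    by rewrite li divr_gt0 // mulr_gt0 // dotC.
  have : 1 - 2 * dot D a / dot a a \is a Num.int by rewrite rpredB ?rpred1.
  move=> /int_num_gt0 h /h{h} h.
  have : 2 * dot D a / dot a a <= 0 by case: h => ?; lra.
  by rewrite pmulr_lle0 ?invr_gt0 // pmulr_rle0.
have Dpos a : positive_root S l a -> dot D a <= 0.
  move: a; apply: simple_ind => // a b _ _ Da Db.
  by rewrite dotDr; lra.
have D0 : D = 0.
  apply/eqP; rewrite -dot_eq0 eq_le dot_ge0 andbT {2}/D dotC dot_suml.
  rewrite big_seq_cond sumr_le0 // => a /andP[ac a0]; rewrite dotC; apply: Dpos.
  by rewrite /positive_root rsub_opp ?(sign_choices_sub cP) // dotNl oppr_gt0.
(* All terms of D are positive on l, so D = 0 means that there are none: no entry of c is negative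
   on l. *)
move=> a ac; have aS := sign_choices_sub cP ac.
rewrite lt_neqAle eq_sym lreg //= leNgt; apply/negP => a0.
have : dot D l = 0 by rewrite D0 dot0l.
rewrite /D dot_suml => /eqP; rewrite psumr_eq0; last first.
  by move=> b b0; rewrite dotNl oppr_ge0 ltW.
move=> /allP /(_ a ac); rewrite a0 /= dotNl oppr_eq0.
by rewrite (negPf (lreg a aS)).
Qed.

(** A nonzero product makes the half sum regular, so c is positive on its chamber, and some element
    of W carries the chamber of H to that one. *)
Lemma half_sum_chamber c : c \in sign_choices P ->
  \prod_(a <- c) dot a (half_sum c) != 0 ->
  exists2 w, W w & all (fun a => w^T *m a \in P) c.
Proof.
move=> cP c0.
have lreg a : a \in S -> dot a (half_sum c) != 0.
  have cn b : b \in c -> dot b (half_sum c) != 0.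
    move=> bc; apply: contra_neq c0 => b0.
    by rewrite (big_rem b bc) /= b0 mul0r.
  move=> aS; have [/cn //|/cn] := sign_choices_total cP aS.
  by rewrite dotNl oppr_eq0.
have lpos := half_sum_regular cP lreg.
have [u Wu uH] := weyl_transitive hS Wfin Hreg lreg.
exists u => //; apply/allP => a ac; have aS := sign_choices_sub cP ac.
have uaS : u^T *m a \in S by apply: weyl_root => //; exact: weyl_tr.
by rewrite !inE uaS -uH // mulmxA (weyl_mul_tr hS) // mul1mx lpos.
Qed.

Lemma half_sum_chamber_perm c w : c \in sign_choices P -> W w ->
  all (fun a => w^T *m a \in P) c -> perm_eq [seq w *m a | a <- P] c.
Proof.
move=> cP Ww /allP wc.
have [uc cN] := sign_choices_uniq (fset_uniq P) posP cP.
have [_ _ sc] := sign_choices_mem cP.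
apply: perm_map_sub; rewrite ?fset_uniq ?sc //.
- move=> a b _ _ /(congr1 (mulmx w^T)).
  by rewrite !mulmxA (weyl_tr_mul hS Ww) !mul1mx.
- move=> a aP; have aS := PS aP.
  have [//|/wc] := sign_choices_total cP (weyl_root hS Ww aS).
  rewrite mulmxN mulmxA (weyl_tr_mul hS Ww) mul1mx => /posP.
  by rewrite dotNl oppr_gt0 => /lt_gtF; rewrite posP.
Qed.

Lemma half_sum_chamber_inj c w1 w2 : c \in sign_choices P -> W w1 -> W w2 ->
  all (fun a => w1^T *m a \in P) c -> all (fun a => w2^T *m a \in P) c -> w1 = w2.
Proof.
move=> cP W1 W2 h1 /allP h2.
have e : w2^T *m w1 = 1%:M.
  apply: (weyl_free hS Hreg); first by apply: weylM => //; exact: weyl_tr.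
  move=> a pa; have aP : a \in P by rewrite mem_positive.
  rewrite -mulmxA -mem_positive; apply: h2.
  by rewrite -(perm_mem (half_sum_chamber_perm cP W1 h1)) map_f.
by rewrite -[w1]mul1mx -(weyl_mul_tr hS W2) -mulmxA e mulmx1.
Qed.

(* Only the sign choices whose half sum is regular contribute; these are the images
   of the positive roots under W, each attained exactly once. *)
Lemma sum_prod_half_sum :
  \sum_(c <- sign_choices P) \prod_(a <- c) dot a (half_sum c) =
  (weyl_order S)%:R * root_prod P (half_sum P).
Proof.
pose F w c : R := (all (fun a => w^T *m a \in P) c)%:R.
have memW w : w \in fset_set W -> W w by rewrite in_fset_set // inE.
transitivity (\sum_(c <- sign_choices P) \sum_(w <- fset_set W)
    F w c * root_prod P (half_sum P)).
  apply: eq_big_seq => c cP; rewrite -mulr_suml.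
  have [[w Ww wc]|nw] := pselect (exists2 w, W w & all (fun a => w^T *m a \in P) c).
    rewrite (big_fsetD1 w) ?in_fset_set ?inE //= [X in _ + X]big_seq_cond [X in _ + X]big1 => [|v].
      rewrite addr0 /F wc mul1r; have pc := half_sum_chamber_perm cP Ww wc.
      rewrite -(perm_big _ pc) big_map; apply: eq_bigr => a _.
      rewrite /half_sum -(perm_big _ pc) big_map -mulmx_sumr scalemxAr.
      by rewrite (weyl_dot hS).
    rewrite andbT in_fsetD1 => /andP[vw /memW Wv]; rewrite /F.
    case vc: (all _ _) => //.
    by rewrite (half_sum_chamber_inj cP Wv Ww vc wc) eqxx in vw.
  rewrite [X in _ = X * _]big_seq [X in _ = X * _]big1 => [|w /memW Ww]; last first.
    by rewrite /F; case: allP => // /allP h; case: nw; exists w.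
  rewrite mul0r; apply/eqP; apply: contrapT => /negP c0; apply: nw.
  exact: half_sum_chamber.
rewrite exchange_big /= /weyl_order -sum1_size natr_sum mulr_suml.
apply: eq_big_seq => w /memW Ww; rewrite -mulr_suml sum_sign_choices_all // => a aP.
have := positive_oppP hS Hreg (weyl_root hS (weyl_tr Ww) (PS aP)).
rewrite -!mem_positive mulmxN => -[] h.
  by rewrite h; move: h; rewrite !mem_positive => /positive_opp ->.
by rewrite h; move: h; rewrite !mem_positive => /positive_opp;
  rewrite opprK => /negPf ->.
Qed.

End HalfSums.

(** * Stabilizer of a point *)

Lemma weyl_subset (R : realType) (d : nat) (S S' : {fset 'cV[R]_d}) :
  (S' `<=` S)%fset -> weyl_group S' `<=` weyl_group S.
Proof. by move=> /fsubsetP S'S w [s ss ->]; exists s => // a /ss /S'S. Qed.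

Lemma mem_roots_vanishing (R : realType) (d : nat) (S : {fset 'cV[R]_d}) Y a :
  (a \in roots_vanishing S Y) = (a \in S) && (dot a Y == 0).
Proof. by rewrite !inE. Qed.

Lemma roots_vanishing_subsystem (R : realType) (d : nat) (S : {fset 'cV[R]_d})
  (Y0 : 'cV[R]_d) : root_subsystem S -> root_subsystem (roots_vanishing S Y0).
Proof.
move=> hS; split=> [a|a b|a b|a c]; rewrite ?mem_roots_vanishing.
- by move=> /andP[/(rsub_neq0 hS)].
- move=> /andP[aS /eqP a0] /andP[bS /eqP b0]; rewrite rsub_reflection //=.
  by rewrite dotC dot_mulmxr reflection_tr reflection_fix // dotC b0.
- by move=> /andP[aS _] /andP[bS _]; exact: (rsub_integral hS).
- by move=> /andP[aS _] /andP[caS _]; exact: (rsub_reduced hS aS).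
Qed.

(* Steinberg's fixed point theorem, for the stabilizer of a single point. *)
Lemma weyl_stabilizer (R : realType) (d : nat) (S : {fset 'cV[R]_d})
    (H Y0 : 'cV[R]_d) w : root_subsystem S -> finite_set (weyl_group S) ->
  (forall a, a \in S -> dot a H != 0) ->
  weyl_group S w -> w *m Y0 = Y0 -> weyl_group (roots_vanishing S Y0) w.
Proof.
move=> hS Wfin Hreg Ww wY.
pose S' := roots_vanishing S Y0.
have mS' a : (a \in S') = (a \in S) && (dot a Y0 == 0) by exact: mem_roots_vanishing.
rewrite -/S'.
have hS' : root_subsystem S' by exact: roots_vanishing_subsystem.
have S'S : (S' `<=` S)%fset by apply/fsubsetP => a; rewrite !mS' => /andP[].
have mS a : a \in S' -> a \in S by move/fsubsetP: S'S; exact.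
have Wfin' : finite_set (weyl_group S').
  by apply: sub_finite_set Wfin; exact: weyl_subset.
have dwY v a : weyl_group S v -> v *m Y0 = Y0 -> dot (v *m a) Y0 = dot a Y0.
  by move=> Wv vY; rewrite -{1}vY (weyl_dot hS).
(* With respect to [S'], [u] brings w H back to the chamber of H. It fixes Y0, and the aim is u w =
   1. *)
have [|u Wu uH] := weyl_transitive (H1 := w *m H) (H2 := H) hS' Wfin' _
    (fun a aS' => Hreg a (mS a aS')).
  move=> a aS'; rewrite dotC -(weyl_dot hS _ _ (weyl_tr Ww)) mulmxA.
  rewrite (weyl_tr_mul hS Ww) mul1mx dotC.
  by apply/Hreg/(weyl_root hS); [exact: weyl_tr|exact: mS].
have WSu := weyl_subset S'S Wu.
have uY : u *m Y0 = Y0.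
  elim/weyl_ind: Wu => [|a v aS' _ IH]; first by rewrite mul1mx.
  rewrite -mulmxA IH; apply: reflection_fix.
  by move: aS'; rewrite !mS' => /andP[_ /eqP].
have [e e0 He] : exists2 e : R, 0 < e & forall a, a \in S -> dot a Y0 != 0 ->
    `|e * dot a H| < `|dot a Y0|.
  have : forall s : seq 'cV[R]_d, exists2 e : R, 0 < e & forall a, a \in s ->
      dot a Y0 != 0 -> `|e * dot a H| < `|dot a Y0|.
    elim=> [|b s [e e0 he]]; first by exists 1.
    have [b0|b0] := eqVneq (dot b Y0) 0.
      exists e => // a; rewrite inE => /predU1P[->|/he //]; by rewrite b0 eqxx.
    have bn : 0 < `|dot b H| + 1 by rewrite ltr_wpDl.
    exists (Num.min e (`|dot b Y0| / (`|dot b H| + 1))).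
      by rewrite lt_min e0 divr_gt0 // normr_gt0.
    move=> a; rewrite inE normrM gtr0_norm; last first.
      by rewrite lt_min e0 divr_gt0 // normr_gt0.
    move=> /predU1P[-> _|/he h /h{h}].
      apply: (@le_lt_trans _ _ (`|dot b Y0| / (`|dot b H| + 1) * `|dot b H|)).
        by rewrite ler_wpM2r // ge_min lexx orbT.
      rewrite mulrAC ltr_pdivrMr // ltr_pM2l ?normr_gt0 //; lra.
    apply: le_lt_trans; rewrite normrM (gtr0_norm e0) ler_wpM2r //.
    by rewrite ge_min lexx.
  by move=> /(_ S).
(* A regular point so close to Y0 that the roots not vanishing at Y0 have the same sign at both,
   while those of [S'] take their sign from H. Both kinds of signs are preserved by u w, which is
   therefore 1 by freeness. *)
pose H' := Y0 + e *: H.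
have sgH' a : a \in S -> dot a Y0 != 0 -> (0 < dot a H') = (0 < dot a Y0) /\ dot a H' != 0.
  move=> aS a0; have := He a aS a0; rewrite /H' dotDr dotZr ltr_norml.
  move: a0; rewrite neq_lt => /orP[] a0;
    rewrite ?(ltr0_norm a0) ?(gtr0_norm a0) => /andP[h1 h2].
    have n : dot a Y0 + e * dot a H < 0 by lra.
    by rewrite (lt_gtF a0) (lt_gtF n) (lt_eqF n).
  have p : 0 < dot a Y0 + e * dot a H by lra.
  by rewrite a0 p (gt_eqF p).
have sgH'0 a : dot a Y0 = 0 -> (0 < dot a H') = (0 < dot a H).
  by move=> a0; rewrite /H' dotDr a0 add0r dotZr pmulr_rgt0.
have Hreg' a : a \in S -> dot a H' != 0.
  move=> aS; have [a0|a0] := eqVneq (dot a Y0) 0; last by have [] := sgH' a aS a0.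
  by rewrite /H' dotDr a0 add0r dotZr mulf_neq0 ?Hreg // gt_eqF.
have Wuw : weyl_group S (u *m w) by exact: weylM.
have uwY : u *m w *m Y0 = Y0 by rewrite -mulmxA wY.
have e1 : u *m w = 1%:M.
  apply: (weyl_free hS Hreg' Wuw) => a /andP[aS a0].
  rewrite /positive_root (weyl_root hS Wuw aS) /=.
  have [aY|aY] := eqVneq (dot a Y0) 0.
    have waS : w *m a \in S' by rewrite !mS' (weyl_root hS Ww aS) dwY // aY eqxx.
    rewrite sgH'0 ?dwY // -mulmxA uH // (weyl_dot hS) //.
    by rewrite -sgH'0.
  have uwaY : dot (u *m w *m a) Y0 != 0 by rewrite dwY.
  have [-> _] := sgH' _ (weyl_root hS Wuw aS) uwaY.
  by rewrite dwY //; have [<- _] := sgH' a aS aY.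
have -> : w = u^T by rewrite -[RHS]mulmx1 -e1 mulmxA (weyl_tr_mul hS WSu) mul1mx.
exact: weyl_tr.
Qed.

(** * Division by linear forms *)

Section ElementaryFunctions.
Variables (R : realType) (V : normedModType R).
Implicit Types (f g l : V -> R) (D : set V) (x y u v : V).

Definition linear_form l :=
  (forall k x y, l (k *: x + y) = k * l x + l y) /\ continuous l.

(* Closed under [f |-> (f - f \o p) / l] for the projection [p] along [v] onto
   the kernel of [l]; this gives division by linear forms without calculus. *)
Inductive elementary D : (V -> R) -> Prop :=
| elementary_form l : linear_form l -> elementary D l
| elementary_cst k : elementary D (fun=> k)
| elementaryD f g : elementary D f -> elementary D g ->
    elementary D (fun x => f x + g x)
| elementaryM f g : elementary D f -> elementary D g ->
    elementary D (fun x => f x * g x)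
| elementaryV f : elementary D f -> (forall x, D x -> 0 < f x) ->
    elementary D (fun x => (f x)^-1)
| elementary_sqrt f : elementary D f -> (forall x, D x -> 0 < f x) ->
    elementary D (fun x => Num.sqrt (f x)).

Lemma elementary_continuous D f : elementary D f ->
  forall x, D x -> {for x, continuous f}.
Proof.
elim=> {f} [l [_ lc] x _|k x _|f g _ IHf _ IHg x Dx|f g _ IHf _ IHg x Dx
  |f _ IHf f0 x Dx|f _ IHf f0 x Dx].
- exact: lc.
- exact: cst_continuous.
- exact: cvgD (IHf x Dx) (IHg x Dx).
- exact: cvgM (IHf x Dx) (IHg x Dx).
- by apply: cvgV; [rewrite gt_eqF ?f0|exact: IHf].
- apply: (continuous_comp (IHf x Dx)); exact: sqrt_continuous.
Qed.

Lemma elementaryN D f : elementary D f -> elementary D (fun x => - f x).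
Proof.
move=> ef; have -> : (fun x => - f x) = fun x => -1 * f x.
  by apply/funext => x; rewrite mulN1r.
by apply: elementaryM ef; exact: elementary_cst.
Qed.

Lemma elementaryX D f n : elementary D f -> elementary D (fun x => f x ^+ n).
Proof.
move=> ef; elim: n => [|n IHn].
  by rewrite (_ : (fun _ => _) = fun=> 1); [exact: elementary_cst|exact/funext].
rewrite (_ : (fun _ => _) = fun x => f x * f x ^+ n); first exact: elementaryM.
by apply/funext => x; rewrite exprS.
Qed.

Lemma elementary_sum D (I : eqType) (s : seq I) (F : I -> V -> R) :
  {in s, forall i, elementary D (F i)} -> elementary D (fun x => \sum_(i <- s) F i x).
Proof.
elim: s => [|i s IHs] eF.
  rewrite (_ : (fun _ => _) = fun=> 0); first exact: elementary_cst.
  by apply/funext => x; rewrite big_nil.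
rewrite (_ : (fun _ => _) = fun x => F i x + \sum_(i <- s) F i x).
  apply: elementaryD; first exact/eF/mem_head.
  by apply: IHs => j js; apply: eF; rewrite inE js orbT.
by apply/funext => x; rewrite big_cons.
Qed.

Section Division.
Variables (D : set V) (l : V -> R) (v : V).
Hypothesis lform : linear_form l.
Local Notation p := (fun x => x - l x *: v).
Hypothesis Dp : forall x, D x -> D (p x).

Let l_lin k x y : l (k *: x + y) = k * l x + l y.
Proof. by case: lform. Qed.

Lemma elementary_comp_proj f : elementary D f -> elementary D (f \o p).
Proof.
elim=> {f} [h [h_lin hc]|k|f g _ IHf _ IHg|f g _ IHf _ IHg
  |f _ IHf f0|f _ IHf f0].
- apply: elementary_form; split=> [k x y|].
    rewrite /= l_lin -h_lin; congr h.
    by rewrite scalerBr scalerDl opprD addrACA scalerA.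
  move=> x; apply: continuous_comp; last exact: hc.
  by apply: cvgB; [exact: cvg_id|apply: cvgZr_tmp; exact: lform.2].
- exact: elementary_cst.
- exact: elementaryD.
- exact: elementaryM.
- by apply: elementaryV => // x Dx; apply/f0/Dp.
- by apply: elementary_sqrt => // x Dx; apply/f0/Dp.
Qed.

(** Difference rules replace derivatives: Leibniz's rule for products, its analogue for inverses,
    and for square roots division by sqrt f + sqrt (f o p), which is positive on D because [p] maps
    D into itself. *)
Lemma elementary_quotient f : elementary D f ->
  exists2 g, elementary D g & forall x, D x -> f x - f (p x) = l x * g x.
Proof.
elim=> {f} [h [h_lin hc]|k|f g ef [f' ef' ff'] eg [g' eg' gg']
  |f g ef [f' ef' ff'] eg [g' eg' gg']|f ef [f' ef' ff'] f0|f ef [f' ef' ff'] f0].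
- exists (fun=> h v); first exact: elementary_cst.
  move=> x _; have -> : x - l x *: v = (- l x) *: v + x by rewrite scaleNr addrC.
  by rewrite h_lin; ring.
- by exists (fun=> 0) => [|x _]; [exact: elementary_cst|rewrite subrr mulr0].
- exists (fun x => f' x + g' x) => [|x Dx]; first exact: elementaryD.
  by rewrite opprD addrACA ff' // gg' // mulrDr.
- exists (fun x => f' x * g x + (f \o p) x * g' x) => [|x Dx].
    by apply: elementaryD; apply: elementaryM => //; exact: elementary_comp_proj.
  have -> : f x * g x - f (p x) * g (p x) =
    (f x - f (p x)) * g x + f (p x) * (g x - g (p x)) by ring.
  by rewrite ff' // gg' //=; ring.
- exists (fun x => - (f' x * ((f x)^-1 * ((f \o p) x)^-1))) => [|x Dx].
    apply: elementaryN; apply: elementaryM => //; apply: elementaryM;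
      apply: elementaryV => //; first exact: elementary_comp_proj.
    by move=> x Dx; apply/f0/Dp.
  have h1 : f x != 0 by rewrite gt_eqF ?f0.
  have h2 : f (p x) != 0 by rewrite gt_eqF //; apply/f0/Dp.
  rewrite mulrN mulrA -ff' //=; field.
  by rewrite h1 h2.
- have sp x : D x -> 0 < Num.sqrt (f x) + Num.sqrt (f (p x)).
    by move=> Dx; rewrite ltr_wpDr ?sqrtr_ge0 ?sqrtr_gt0 ?f0.
  exists (fun x => f' x * (Num.sqrt (f x) + Num.sqrt ((f \o p) x))^-1) => [|x Dx].
    apply: elementaryM => //; apply: elementaryV => //; apply: elementaryD;
      apply: elementary_sqrt => //; first exact: elementary_comp_proj.
    by move=> x Dx; apply/f0/Dp.
  rewrite mulrA -ff' //=; apply: (canRL (mulfK _)); first by rewrite gt_eqF ?sp.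
  rewrite -subr_sqr !sqr_sqrtr //; apply: ltW; [|exact: f0].
  exact/f0/Dp.
Qed.

End Division.

(** One form is divided out at a time. The quotient by [l i] still vanishes where another form [l j]
    does: this is clear off the kernel of [l i], and follows on it by continuity, approaching x
    inside the kernel of [l j]. *)
Lemma elementary_division D (I : eqType) (L : seq I) (l : I -> V -> R)
    (v : I -> V) (c : V) f :
  (forall i, linear_form (l i)) -> uniq L ->
  {in L, forall i, [/\ l i (v i) = 1, l i c = 0 &
     forall x, D x -> D (x - l i x *: v i)]} ->
  {in L &, forall i j, i != j -> exists2 u, l j u = 0 & l i u != 0} ->
  (forall x y (t : R), D x -> D y -> 0 < t <= 1 -> D ((1 - t) *: x + t *: y)) ->
  (forall u, exists2 e : R, 0 < e & D (c + e *: u)) ->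
  elementary D f -> {in L, forall i x, D x -> l i x = 0 -> f x = 0} ->
  exists2 g, elementary D g & forall x, D x -> f x = (\prod_(i <- L) l i x) * g x.
Proof.
move=> lf + + + Dcvx Dabs; elim: L f => [|i L IHL] f uL Lp Lind ef f0.
  by exists f => // x _; rewrite big_nil mul1r.
have /andP[iL uL'] : (i \notin L) && uniq L by [].
have LS j : j \in L -> j \in i :: L by rewrite inE => ->; rewrite orbT.
have iL' : i \in i :: L by rewrite mem_head.
have [lv lc Dp] := Lp i iL'.
have lin j k x y : l j (k *: x + y) = k * l j x + l j y by case: (lf j).
have lZ j k x : l j (k *: x) = k * l j x.
  have lj0 : l j 0 = 0.
    by have := lin j 1 0 0; rewrite scaler0 addr0 mul1r => h; lra.
  by rewrite -[k *: x]addr0 lin lj0 addr0.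
have [g eg fg] := elementary_quotient (lf i) Dp ef.
have {}fg x : D x -> f x = l i x * g x.
  move=> Dx; rewrite -fg // (f0 i iL' (x - l i x *: v i)) ?subr0 //; first exact: Dp.
  by rewrite addrC -scaleNr lin lv mulr1 addNr.
have [|j k jL kL|j jL x Dx jx|h eh gh] := IHL g uL' _ _ eg.
- by move=> j /LS; exact: Lp.
- by apply: Lind; exact: LS.
- have [ix|ix] := eqVneq (l i x) 0; last first.
    apply: (mulfI ix); rewrite -fg // mulr0; exact: f0 (LS j jL) x Dx jx.
  have ij : i != j by apply: contraNneq iL => ->.
  have [u ju iu] := Lind i j iL' (LS j jL) ij.
  have [e e0 De] := Dabs u.
  have [_ jc _] := Lp j (LS j jL).
  (* For 0 < t <= 1 this point lies in D by convexity and in the kernel of [l j], but not in that of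
     [l i]: x and c are in both kernels, u only in the former. *)
  pose y t := (1 - t) *: x + t *: (c + e *: u).
  have yx : y t @[t --> (0:R)^'+] --> x.
    apply: cvg_at_right_filter; rewrite -[X in _ --> X]addr0.
    rewrite -[X in _ --> X + _]scale1r -[in X in _ --> _ + X](scale0r (c + e *: u)).
    rewrite -[in X in _ --> X *: _ + _](subr0 1).
    apply: cvgD; apply: cvgZr_tmp; last exact: cvg_id.
    by apply: cvgB; [exact: cvg_cst|exact: cvg_id].
  have gy : g (y t) @[t --> (0:R)^'+] --> g x.
    by apply: continuous_cvg yx; exact: elementary_continuous eg x Dx.
  suff gy0 : g (y t) @[t --> (0:R)^'+] --> (0:R) by exact: cvg_unique gy gy0.
  apply: cvg_near_cst; near=> t.
  have t0 : 0 < t by near: t; exact: nbhs_right_gt.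
  have t1 : t <= 1 by near: t; exact: nbhs_right_le.
  have Dy : D (y t) by apply: Dcvx; rewrite ?t0.
  have iy : l i (y t) != 0.
    rewrite /y lin ix mulr0 add0r lZ [c + _]addrC lin lc addr0.
    by rewrite !mulf_neq0 // gt_eqF.
  apply: (mulfI iy); rewrite -fg // mulr0; apply: (f0 j (LS j jL)) => //.
  by rewrite /y lin jx mulr0 add0r lZ [c + _]addrC lin ju jc mulr0 addr0 mulr0.
- exists h => // x Dx; rewrite big_cons -mulrA -gh //; exact: fg.
Unshelve. all: by end_near. Qed.

End ElementaryFunctions.

(** * Alternating sums *)

Section Alternating.
Variables (R : realType) (d : nat).
Implicit Types (a b X Y Z : 'cV[R]_d) (w : 'M[R]_d) (p : 'cV[R]_d * 'cV[R]_d).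

(** The flag selects the variable, X for [true] and Y for [false], so that the forms <a, X> and <a,
    Y> make up a single family on pairs. *)
Definition side (s : bool) p : 'cV[R]_d := if s then p.1 else p.2.
Definition inject (s : bool) a : 'cV[R]_d * 'cV[R]_d := if s then (a, 0) else (0, a).

Lemma dot_continuous (T : topologicalType) (f g : T -> 'cV[R]_d) (x : T) :
  {for x, continuous f} -> {for x, continuous g} ->
  {for x, continuous (fun x => dot (f x) (g x))}.
Proof.
move=> fc gc; apply: cvg_big => [|i _]; first exact: add_continuous.
by apply: cvgM; [exact: (continuous_comp fc (@coord_continuous _ _ _ _ _ _))|
  exact: (continuous_comp gc (@coord_continuous _ _ _ _ _ _))].
Qed.

Lemma side_continuous s : continuous (side s).
Proof. by case: s => p; [exact: cvg_fst|exact: cvg_snd]. Qed.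

Lemma linear_form_side s a : linear_form (fun p => dot a (side s p)).
Proof.
split=> [k x y|]; first by case: s; rewrite /= dotDr dotZr.
by move=> p; apply: dot_continuous; [exact: cst_continuous|exact: side_continuous].
Qed.

Lemma elementary_coord D s i : elementary D (fun p => side s p i 0).
Proof.
rewrite (_ : (fun _ => _) = fun p => dot (delta_mx i 0) (side s p)).
  exact/elementary_form/linear_form_side.
apply/funext => p; rewrite /dot (bigD1 i) //= mxE !eqxx mul1r big1 ?addr0 // => j ji.
by rewrite mxE (negPf ji) mul0r.
Qed.

Lemma elementary_dot D s t w : elementary D (fun p => dot (side s p) (w *m side t p)).
Proof.
apply: elementary_sum => i _; apply: elementaryM; first exact: elementary_coord.
rewrite (_ : (fun _ => _) = fun p => \sum_j w i j * side t p j 0); last first.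
  by apply/funext => p; rewrite mxE.
apply: elementary_sum => j _; apply: elementaryM; first exact: elementary_cst.
exact: elementary_coord.
Qed.

Lemma dot_side_inject s t a b : dot a (side s (inject t b)) = (s == t)%:R * dot a b.
Proof. by case: s; case: t; rewrite /= ?dot0r ?mul1r ?mul0r. Qed.

Lemma root_prodZ (S : {fset 'cV[R]_d}) (t : R) X :
  root_prod S (t *: X) = t ^+ #|` S| * root_prod S X.
Proof.
rewrite /root_prod; under eq_bigr => a _ do rewrite dotZr.
by rewrite big_split /= big_const_seq count_predT -Monoid.iteropE.
Qed.

(** Multiplying w on the left by the reflection in a leaves <X, w Y> unchanged, since X is fixed by
    it, and changes the sign of det w. *)
Lemma alternating_suml (A : {fset 'M[R]_d}) a (G : R -> R) X Y : a != 0 ->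
  (forall w, w \in A -> reflection a *m w \in A) -> dot a X = 0 ->
  \sum_(w <- A) \det w * G (dot X (w *m Y)) = 0.
Proof.
move=> a0 As aX; set S := \sum_(_ <- _) _.
suff : S = - S by move=> h; lra.
have pA : perm_eq [seq reflection a *m w | w <- A] A.
  apply: perm_map_sub => //; rewrite ?fset_uniq // => w v _ _.
  by move=> /(congr1 (mulmx (reflection a))); rewrite !mulmxA reflectionK // !mul1mx.
rewrite {1}/S -(perm_big _ pA) big_map -sumrN; apply: eq_bigr => w _.
rewrite det_mulmx det_reflection // mulN1r mulNr -mulmxA (dot_mulmxr (reflection a)).
by rewrite reflection_tr reflection_fix.
Qed.

Lemma alternating_sumr (A : {fset 'M[R]_d}) a (G : R -> R) X Y : a != 0 ->
  (forall w, w \in A -> w *m reflection a \in A) -> dot a Y = 0 ->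
  \sum_(w <- A) \det w * G (dot X (w *m Y)) = 0.
Proof.
move=> a0 As aY; set S := \sum_(_ <- _) _.
suff : S = - S by move=> h; lra.
have pA : perm_eq [seq w *m reflection a | w <- A] A.
  apply: perm_map_sub => //; rewrite ?fset_uniq // => w v _ _.
  move=> /(congr1 (mulmxr (reflection a))) /=.
  by rewrite -!mulmxA reflectionK // !mulmx1.
rewrite {1}/S -(perm_big _ pA) big_map -sumrN; apply: eq_bigr => w _.
by rewrite det_mulmx det_reflection // mulrN1 mulNr -mulmxA reflection_fix.
Qed.

Section Division.
Variables (S : {fset 'cV[R]_d}) (H : 'cV[R]_d).
Hypothesis hS : root_subsystem S.
Local Notation P := [fset a in S | 0 < dot a H]%fset.

(** The directions a / |a|^2 make the projections orthogonal. Forms in different variables are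
    independent at once. Distinct positive roots are not proportional, S being reduced, so the part
    of one orthogonal to the other separates their kernels. *)
Lemma alternating_division (D : set ('cV[R]_d * 'cV[R]_d)) c f :
  {in P, forall a s p, D p ->
     D (p - dot a (side s p) *: inject s ((dot a a)^-1 *: a))} ->
  {in P, forall a s, dot a (side s c) = 0} ->
  (forall x y (t : R), D x -> D y -> 0 < t <= 1 -> D ((1 - t) *: x + t *: y)) ->
  (forall u, exists2 e : R, 0 < e & D (c + e *: u)) ->
  elementary D f -> {in P, forall a s p, D p -> dot a (side s p) = 0 -> f p = 0} ->
  exists2 g, elementary D g &
    forall p, D p -> f p = root_prod P p.1 * root_prod P p.2 * g p.
Proof.
move=> Dp c0 Dcvx Dabs ef f0.
have PS a : a \in P -> a \in S by rewrite !inE => /andP[].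
have aa a : a \in P -> dot a a != 0 by move=> /PS aS; rewrite dot_eq0 (rsub_neq0 hS).
pose L := [seq (a, true) | a <- P] ++ [seq (a, false) | a <- P].
have mL i : i \in L -> i.1 \in P.
  by rewrite mem_cat => /orP[] /mapP[a aP ->].
have [||i j iL jL ij|i iL p Dp0|g eg fg] := @elementary_division _ _ D _ L
    (fun i p => dot i.1 (side i.2 p)) (fun i => inject i.2 ((dot i.1 i.1)^-1 *: i.1))
    c f (fun i => linear_form_side i.2 i.1) _ _ _ Dcvx Dabs ef.
- rewrite cat_uniq !map_inj_uniq ?fset_uniq => [|x y []//|x y []//].
  by rewrite andbT; apply/hasPn => _ /mapP[a _ ->]; apply/negP => /mapP[].
- move=> i /mL iP; split=> [||p]; [|exact: c0|exact: Dp].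
  by rewrite dot_side_inject eqxx mul1r dotZr mulVf // aa.
- have iP := mL i iL; have jP := mL j jL; have [eij|nij] := eqVneq i.2 j.2;
  last first.
    exists (inject i.2 i.1); rewrite dot_side_inject ?eqxx ?mul1r ?aa //.
    by rewrite eq_sym (negPf nij) mul0r.
  have ne : i.1 != j.1.
    by apply: contra ij => /eqP e;
      rewrite (surjective_pairing i) e eij -surjective_pairing.
  have np k : i.1 != k *: j.1.
    apply/eqP => e; have [k1|k1] : k = 1 \/ k = -1.
      by apply: (rsub_reduced hS (PS _ jP)); rewrite -e PS.
    - by move: ne; rewrite e k1 scale1r eqxx.
    - move: iP jP; rewrite e k1 !inE dotZl mulN1r oppr_gt0.
      by move=> /andP[_ /lt_gtF ->]; rewrite andbF.
  have jj : 0 < dot j.1 j.1 by rewrite dot_gt0 (rsub_neq0 hS) ?PS.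
  have cs := cauchy_schwarz_strict (rsub_neq0 hS (PS _ jP)) np.
  exists (inject i.2 (i.1 - (dot j.1 i.1 / dot j.1 j.1) *: j.1)).
    rewrite dot_side_inject -eij eqxx mul1r dotBr dotZr divfK ?subrr //.
    by rewrite gt_eqF.
  rewrite dot_side_inject eqxx mul1r dotBr dotZr (dotC i.1 j.1) mulrAC -expr2 subr_eq0.
  by apply/eqP => e; move: cs; rewrite mulrC e divfK ?ltxx // gt_eqF.
- exact: f0 (mL i iL) _ _ Dp0.
- by exists g => // p Dp0; rewrite fg // big_cat !big_map.
Qed.

End Division.
End Alternating.

(** * Alternating power sums *)

Section PowerSums.
Variables (R : realType) (d : nat) (S : {fset 'cV[R]_d}) (H : 'cV[R]_d).
Hypothesis hS : root_subsystem S.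
Hypothesis Hreg : forall a, a \in S -> dot a H != 0.
Hypothesis Wfin : finite_set (weyl_group S).
Local Notation W := (weyl_group S).
Local Notation P := [fset a in S | 0 < dot a H]%fset.
Implicit Types (X Z : 'cV[R]_d).

Definition alternating_power n X Z : R :=
  \sum_(w <- fset_set W) \det w * dot X (w *m Z) ^+ n.

Lemma mem_fset_weyl w : (w \in fset_set W) = `[< W w >].
Proof. by rewrite in_fset_set // in_setE; apply/idP/asboolP; rewrite inE. Qed.

Lemma root_prod_regular X : (forall a, a \in S -> dot a X != 0) -> root_prod P X != 0.
Proof.
move=> Xreg; rewrite /root_prod big_seq prodf_seq_neq0; apply/allP => a aP.
by apply/implyP => _; apply: Xreg; move: aP; rewrite !inE => /andP[].
Qed.

(* Both sides are homogeneous, so only the value of the quotient at the origin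
   matters. *)
Lemma alternating_power_root_prod : exists2 c : R,
  (forall X Z, alternating_power #|` P| X Z = c * (root_prod P X * root_prod P Z)) &
  forall n X Z, (n < #|` P|)%N -> alternating_power n X Z = 0.
Proof.
pose F n (p : 'cV[R]_d * 'cV[R]_d) := alternating_power n p.1 p.2.
have divF n : exists2 g, elementary setT g &
    forall p, F n p = root_prod P p.1 * root_prod P p.2 * g p.
  have [||||||g eg Fg] := @alternating_division _ _ S H hS setT 0 (F n) => //.
  - by move=> a _ [] /=; rewrite dot0r.
  - by move=> u; exists 1.
  - apply: elementary_sum => w _; apply: elementaryM; first exact: elementary_cst.
    exact/elementaryX/(elementary_dot _ true false).
  - move=> a; rewrite !inE => /andP[aS _] s p _ ap; have a0 := rsub_neq0 hS aS.
    have Wa := weyl_reflection aS.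
    case: s ap => ap.
      apply: (alternating_suml (a := a) (fun x => x ^+ n)) => // w.
      by rewrite !mem_fset_weyl => /asboolP Ww; apply/asboolP/weylM.
    apply: (alternating_sumr (a := a) (fun x => x ^+ n)) => // w.
    by rewrite !mem_fset_weyl => /asboolP Ww; apply/asboolP/weylM.
  - by exists g => // p; exact: Fg.
have scale n (t : R) X Z : F n (t *: X, t *: Z) = t ^+ (2 * n) * F n (X, Z).
  rewrite /F /alternating_power mulr_sumr; apply: eq_bigr => w _ /=.
  by rewrite -scalemxAr dotZl dotZr mulrA exprMn -expr2 -exprM mulrCA.
have lim n g X Z : (n <= #|` P|)%N -> elementary setT g ->
    (forall p, F n p = root_prod P p.1 * root_prod P p.2 * g p) ->
    F n (X, Z) = 0 ^+ (2 * (#|` P| - n)) * (root_prod P X * root_prod P Z * g (0, 0)).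
  move=> nP eg Fg; set k := (_ - n)%N.
  (* [F n] is homogeneous of degree 2n and the root products together of degree 2 |P|, so [G] is
     constant for t > 0. At t = 0 the power of t is 1 if n = |P| and 0 if n < |P|. *)
  pose G (t : R) := t ^+ (2 * k) * (root_prod P X * root_prod P Z * g (t *: X, t *: Z)).
  have GF t : 0 < t -> G t = F n (X, Z).
    move=> t0; apply: (mulfI (expf_neq0 (2 * n) (lt0r_neq0 t0))).
    have ek : t ^+ (2 * n) * t ^+ (2 * k) = t ^+ #|` P| * t ^+ #|` P|.
      by rewrite -!exprD -mulnDr subnKC // mul2n addnn.
    rewrite -scale Fg /= !root_prodZ /G. rewrite [LHS]mulrA. rewrite ek;
      move: (t ^+ #|` P|) (g _) => *; ring.
  have c1 : G t @[t --> (0:R)^'+] --> G 0.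
    apply: cvg_at_right_filter; apply: cvgM; first exact: exprn_continuous.
    apply: cvgM; first exact: cvg_cst.
    have cp : (t *: X, t *: Z) @[t --> (0:R)] --> ((0:R) *: X, (0:R) *: Z).
      have cZ (A : 'cV[R]_d) : t *: A @[t --> (0:R)] --> (0:R) *: A.
        by apply: cvgZr_tmp; exact: cvg_id.
      exact: (cvg_pair (cZ X) (cZ Z)).
    by apply: continuous_cvg cp; exact: (elementary_continuous eg).
  have c2 : G t @[t --> (0:R)^'+] --> F n (X, Z).
    apply: cvg_near_cst; near=> t; apply: GF; near: t; exact: nbhs_right_gt.
  by have := cvg_unique _ c2 c1; rewrite /G !scale0r; exact.
have [g eg Fg] := divF #|` P|; exists (g (0, 0)) => [X Z|n X Z nP].
  by have := lim _ _ X Z (leqnn _) eg Fg; rewrite /F /= subnn muln0 expr0 mul1r mulrC.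
have [h eh Fh] := divF n.
have := lim _ _ X Z (ltnW nP) eh Fh; rewrite /F /= expr0n muln_eq0 /= subn_eq0.
by rewrite leqNgt nP mul0r.
Unshelve. all: by end_near. Qed.

(** The lowest-degree part of the Weyl denominator formula. The constant c is found by computing a
    sum [T] over sign choices twice: [polarization], for one w at a time, gives |W| n! pi(H)^2, and
    [sum_prod_half_sum] gives c |W| pi(rho) pi(H)^2 with rho the half sum. As n! is nonzero, so is
    pi(rho). *)
Lemma alternating_powerE : root_prod P (half_sum P) != 0 /\
  forall X Z, alternating_power #|` P| X Z =
    (#|` P|)`!%:R / root_prod P (half_sum P) * (root_prod P X * root_prod P Z).
Proof.
have [c cP _] := alternating_power_root_prod.
have pH := root_prod_regular Hreg.
set n := #|` P| in cP *.
have W0 : (weyl_order S)%:R != 0 :> R.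
  rewrite pnatr_eq0 -lt0n /weyl_order cardfs_gt0; apply/fset0Pn; exists 1%:M.
  by rewrite mem_fset_weyl; apply/asboolP; exact: weyl1.
have key : c * root_prod P (half_sum P) = n`!%:R.
  have := sum_prod_half_sum hS Hreg Wfin.
  set s := \sum_(_ <- _) _ => es.
  pose T := \sum_(x <- sign_choices P)
    (\prod_(a <- x) dot a H) * alternating_power n (half_sum x) H.
  have T1 : T = c * root_prod P H * root_prod P H * s.
    rewrite /T /s mulr_sumr; apply: eq_big_seq => x xP; rewrite cP.
    have := sign_choices_prod H (half_sum x) xP; rewrite -!/(root_prod _ _) => e.
    transitivity (c * root_prod P H * ((\prod_(a <- x) dot a H) * root_prod P (half_sum x))).
      by ring.
    by rewrite e; ring.
  have T2 : T = (weyl_order S)%:R * (n`!%:R * root_prod P H * root_prod P H).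
    rewrite /T /weyl_order -sum1_size natr_sum mulr_suml.
    under eq_bigr => x _ do rewrite mulr_sumr.
    rewrite exchange_big /=; apply: eq_big_seq => w;
      rewrite mem_fset_weyl => /asboolP Ww.
    have := @polarization _ _ P H (w *m H) n; rewrite eqxx leqnn => /(_ isT) pol.
    have dd : \det w * \det w = 1.
      by rewrite -{1}det_tr -det_mulmx (weyl_tr_mul hS Ww) det1.
    transitivity (\det w * \sum_(x <- sign_choices P)
        (\prod_(a <- x) dot a H) * dot (half_sum x) (w *m H) ^+ n).
      by rewrite mulr_sumr; apply: eq_bigr => x _; rewrite mulrCA.
    rewrite pol -!/(root_prod _ _) root_prod_weyl // mul1r.
    transitivity (\det w * \det w * (n`!%:R * root_prod P H * root_prod P H));
      first by ring.
    by rewrite dd mul1r.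
  have : (weyl_order S)%:R * (root_prod P H * root_prod P H) *
     (c * root_prod P (half_sum P)) =
     (weyl_order S)%:R * (root_prod P H * root_prod P H) * n`!%:R.
    by have := T1; rewrite T2 es => e;
      transitivity (c * root_prod P H * root_prod P H *
      ((weyl_order S)%:R * root_prod P (half_sum P))); [ring|rewrite -e; ring].
  by apply: mulfI; rewrite !mulf_neq0.
have n0 : root_prod P (half_sum P) != 0.
  apply/eqP => e; move: key; rewrite e mulr0 => /esym/eqP.
  by rewrite pnatr_eq0 gtn_eqF // fact_gt0.
by split=> // X Z; rewrite cP -key mulfK.
Qed.

End PowerSums.

(** * Taylor expansion of a radial power *)

Section Taylor.
Variable R : realType.
Implicit Types (a h : R) (d n k : nat).

Definition radial_power d a h : R := (Num.sqrt (a - 2 * h) ^+ d)^-1.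

(** The binomial series of (a - 2h)^(-d/2) in h, half-integral powers being written through the
    square root. *)
Definition taylor_coef d a k : R :=
  pochhammer (d%:R / 2) k / k`!%:R * 2 ^+ k / (a ^+ k * Num.sqrt a ^+ d).

Lemma is_derive_exprn n (x : R) : is_derive x 1 (fun y => y ^+ n) (n%:R * x ^+ n.-1).
Proof.
elim: n => [|n IHn].
  rewrite mul0r (_ : (fun _ => _) = cst 1); first exact: is_derive_cst.
  by apply/funext => y; rewrite expr0.
have -> : (fun y : R => y ^+ n.+1) = (@idfun R) * (fun y => y ^+ n).
  by apply/funext => y; rewrite exprS.
apply: is_derive_eq; rewrite /GRing.scale /= -natr1 mulrDl mul1r.
case: n {IHn} => [|n]; first by rewrite /= !(mul0r, mulr0, mulr1).
by rewrite /= mulr1 mulrCA -exprS.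
Qed.

Lemma is_derive_radial_power d a h : 2 * h < a ->
  is_derive h 1 (radial_power d a) (d%:R * radial_power d.+2 a h).
Proof.
move=> ha; have u0 : 0 < a - 2 * h by rewrite subr_gt0.
have s0 : 0 < Num.sqrt (a - 2 * h) by rewrite sqrtr_gt0.
have d1 : is_derive h 1 (fun h => a - 2 * h) (- 2).
  have -> : (fun h => a - 2 * h) = cst a - (2 *: (@idfun R)) by apply/funext.
  by apply: is_derive_eq; rewrite sub0r /GRing.scale /= mulr1.
have d2 := @is_derive1_comp _ _ (fun h => a - 2 * h) _ _ _ (is_derive1_sqrt u0) d1.
have d3 := @is_derive1_comp _ _ (Num.sqrt \o (fun h =>
  a - 2 * h)) _ _ _ (is_derive_exprn d _) d2.
have d4 := @is_deriveV _ (fun h => Num.sqrt (a - 2 * h) ^+ d) h _ _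
  (lt0r_neq0 (exprn_gt0 d s0)) d3.
apply: (is_derive_eq d4); rewrite /radial_power /GRing.scale /=.
case: d {d3 d4} => [|d]; first by rewrite !mul0r mulr0.
rewrite !exprS /=; field.
by rewrite !gt_eqF // exprn_gt0.
Qed.


Lemma taylor_coefS d a k : 0 < a ->
  k.+1%:R * taylor_coef d a k.+1 = d%:R * taylor_coef d.+2 a k.
Proof.
move=> a0; have s0 : 0 < Num.sqrt a by rewrite sqrtr_gt0.
have ph : pochhammer (d%:R / 2 : R) k.+1 = d%:R / 2 * pochhammer (d.+2%:R / 2) k.
  rewrite /pochhammer big_ord_recl addr0; congr (_ * _); apply: eq_bigr => i _.
  by rewrite lift0 -!natr1; field.
have sd2 : Num.sqrt a ^+ d.+2 = a * Num.sqrt a ^+ d.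
  by rewrite !exprS mulrA -expr2 sqr_sqrtr // ltW.
rewrite /taylor_coef ph factS natrM sd2 (exprS a) (exprS 2).
have f0 : k`!%:R != 0 :> R by rewrite pnatr_eq0 -lt0n fact_gt0.
have k0 : k.+1%:R != 0 :> R by rewrite pnatr_eq0.
have ak : a ^+ k != 0 by rewrite expf_neq0 // gt_eqF.
have sd : Num.sqrt a ^+ d != 0 by rewrite expf_neq0 // gt_eqF.
move: (pochhammer _ _) (k`!%:R) (a ^+ k) (Num.sqrt a ^+ d) (k.+1%:R) (2 ^+ k) f0 k0 ak sd
  => p f ak sd kk tk f0 k0 ak0 sd0.
by field; rewrite ?f0 ?k0 ?ak0 ?sd0 ?gt_eqF.
Qed.

Lemma is_derive_taylor_sum (c : nat -> R) n (x : R) :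
  is_derive x 1 (fun h => \sum_(k < n.+1) c k * h ^+ k)
    (\sum_(k < n) k.+1%:R * c k.+1 * x ^+ k).
Proof.
elim: n => [|n IHn].
  rewrite big_ord0 (_ : (fun _ => _) = cst (c 0%N)); first exact: is_derive_cst.
  by apply/funext => h; rewrite big_ord1 expr0 mulr1.
have -> : (fun h => \sum_(k < n.+2) c k * h ^+ k) =
    (fun h => \sum_(k < n.+1) c k * h ^+ k) + (c n.+1 *: (fun h : R => h ^+ n.+1)).
  by apply/funext => h; rewrite big_ord_recr.
have := is_derive_exprn n.+1 x => dn.
apply: (is_derive_eq (is_deriveD IHn (is_deriveZ _ dn))).
rewrite big_ord_recr /=; congr (_ + _).
by rewrite /GRing.scale /= mulrA (mulrC (c _)).
Qed.

(** The derivative of the remainder for d is d times the remainder of one order less for d + 2, so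
    the mean value theorem gives an induction on n for all d at once. The case n = 0 holds because a
    - 2h >= a/2 when |h| <= a/4. *)
Lemma radial_power_taylor n d a : 0 < a -> exists2 C : R, 0 <= C & forall h, `|h| <= a / 4 ->
  `|radial_power d a h - \sum_(k < n) taylor_coef d a k * h ^+ k| <= C * `|h| ^+ n.
Proof.
move=> a0; elim: n d => [|n IHn] d.
  exists (Num.sqrt (a / 2) ^+ d)^-1 => [|h].
    by rewrite invr_ge0 exprn_ge0 // sqrtr_ge0.
  rewrite ler_norml => /andP[h1 h2].
  rewrite big_ord0 subr0 expr0 mulr1 /radial_power ger0_norm; last first.
    by rewrite invr_ge0 exprn_ge0 // sqrtr_ge0.
  have p1 : 0 < a / 2 by lra.
  have p2 : 0 < a - 2 * h by lra.
  rewrite lef_pV2 ?posrE ?exprn_gt0 ?sqrtr_gt0 //.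
  by rewrite lerXn2r ?nnegrE ?sqrtr_ge0 // ler_sqrt; lra.
have [C C0 hC] := IHn d.+2; exists (d%:R * C) => [|h ha].
  by rewrite mulr_ge0.
pose F h := radial_power d a h - \sum_(k < n.+1) taylor_coef d a k * h ^+ k.
pose F' h := d%:R * (radial_power d.+2 a h -
  \sum_(k < n) taylor_coef d.+2 a k * h ^+ k).
have F0 : F 0 = 0.
  rewrite /F big_ord_recl big1 => [|i _]; last by rewrite expr0n mulr0.
  rewrite addr0 expr0 mulr1 /radial_power /taylor_coef /pochhammer big_ord0.
  by rewrite mulr0 subr0 fact0 invr1 !expr0 !mul1r subrr.
have dF (x : R) : `|x| <= a / 4 -> is_derive x (1 : R) F (F' x).
  rewrite ler_norml => /andP[x1 x2]; have xa : 2 * x < a by lra.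
  have d1 := is_derive_radial_power d xa.
  have d2 := is_derive_taylor_sum (taylor_coef d a) n x.
  apply: (is_derive_eq (is_deriveB d1 d2)); rewrite /F' mulrBr; congr (_ - _).
  by rewrite mulr_sumr; apply: eq_bigr => k _; rewrite taylor_coefS // -mulrA.
have cF (x : R) : `|x| <= a / 4 -> {for x, continuous F}.
  by move=> xa; have /@ex_derive := dF x xa;
    move=> /derivable1_diffP/differentiable_continuous.
have [c ch Fh] : exists2 c, `|c| <= `|h| & F h = F' c * h.
  have [h0|h0] := leP 0 h.
    have [x||c] := MVT_segment (f := F) (df := F') h0.
    - rewrite in_itv /= => /andP[x0 xh]; apply: dF; move: ha.
      by rewrite (ger0_norm h0) (ger0_norm (ltW x0)) => *; lra.
    - apply: continuous_in_subspaceT => x; rewrite inE /= in_itv /= => /andP[x0 xh].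
      by apply: cF; move: ha; rewrite !ger0_norm // => *; lra.
    - rewrite in_itv /= => /andP[c0 ch]; rewrite F0 !subr0 => e.
      by exists c => //; rewrite !ger0_norm.
  have [x||c] := MVT_segment (f := F) (df := F') (ltW h0).
  - rewrite in_itv /= => /andP[x0 xh]; apply: dF; move: ha.
    by rewrite !ltr0_norm // => *; lra.
  - apply: continuous_in_subspaceT => x; rewrite inE /= in_itv /= => /andP[x0 xh].
    by apply: cF; move: ha; rewrite (ltr0_norm h0) (ler0_norm xh) => *; lra.
  - rewrite in_itv /= => /andP[c0 ch]; rewrite F0 !sub0r mulrN => /oppr_inj e.
    by exists c => //; rewrite (ltr0_norm h0) (ler0_norm ch); lra.
rewrite -/(F h) Fh normrM exprSr mulrA ler_wpM2r // /F' normrM normr_nat -mulrA.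
rewrite ler_wpM2l //; apply: le_trans (hC c _) _; first exact: le_trans ch ha.
by rewrite ler_wpM2l // lerXn2r ?nnegrE.
Qed.

End Taylor.

(** * Positivity of the Gamma function at half-integers *)

Section GammaPositive.
Variable R : realType.
Local Notation mu := (@lebesgue_measure R).

Lemma cvgy_sqrt : Num.sqrt x @[x --> +oo%R] --> (+oo%R : set_system R).
Proof.
apply/cvgryPge => A; near=> x.
have Ax : A ^+ 2 <= x by near: x; apply: nbhs_pinfty_ge; exact: num_real.
by rewrite (le_trans (ler_norm A)) // -sqrtr_sqr ler_wsqrtr.
Unshelve. all: by end_near. Qed.

Lemma continuous_expRN_sqrt : continuous (fun x : R => expR (- Num.sqrt x)).
Proof.
move=> x; apply: (@continuous_comp _ _ _ (fun x => - Num.sqrt x) expR).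
  by apply: cvgN; exact: sqrt_continuous.
exact: continuous_expR.
Qed.

Lemma continuous_expR_sqrt (x : R) : 0 < x ->
  {for x, continuous (fun x : R => (Num.sqrt x)^-1 * expR (- Num.sqrt x))}.
Proof.
move=> x0; apply: cvgM; last exact: continuous_expRN_sqrt.
by apply: cvgV; [rewrite gt_eqF // sqrtr_gt0|exact: sqrt_continuous].
Qed.

(** An antiderivative is -2 exp(-sqrt x). The bound is uniform in a. *)
Lemma integral_expR_sqrt (a : R) : 0 < a ->
  (\int[mu]_(x in `[a, +oo[) ((Num.sqrt x)^-1 * expR (- Num.sqrt x))%:E
    <= 2%:E)%E.
Proof.
move=> a0.
pose F x : R := - 2 * expR (- Num.sqrt x).
pose f x : R := (Num.sqrt x)^-1 * expR (- Num.sqrt x).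
have dF (x : R) : 0 < x -> is_derive x (1 : R) F (f x).
  move=> x0; have d1 := is_derive1_sqrt x0.
  have d2 : is_derive x (1 : R) (expR \o (- Num.sqrt)) (expR (- Num.sqrt x) * - (2 * Num.sqrt x)^-1).
    apply: is_derive1_comp; last exact: is_deriveN.
  have s0 : Num.sqrt x != 0 by rewrite gt_eqF // sqrtr_gt0.
  have d3 := is_deriveZ (- 2) d2.
  apply: (is_derive_eq d3); rewrite /f /GRing.scale /=; by field.
rewrite (@ge0_continuous_FTC2y _ f F a 0).
- by rewrite sub0e -EFinN lee_fin /F mulNr opprK ler_piMr // expR_le1 oppr_le0 sqrtr_ge0.
- by move=> x _; rewrite /f mulr_ge0 ?invr_ge0 ?sqrtr_ge0 ?expR_ge0.
- apply: continuous_in_subspaceT => x; rewrite inE /= in_itv /= andbT => ax.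
  by apply: continuous_expR_sqrt; exact: lt_le_trans ax.
- rewrite -(mulr0 (- 2)); apply: cvgM; first exact: cvg_cst.
  exact: (cvg_comp _ _ cvgy_sqrt (@cvgr_expR R)).
- by move=> x ax; have /@ex_derive := dF x (lt_trans a0 ax).
- by apply: cvg_at_right_filter; apply: cvgM;
  [exact: cvg_cst|exact: continuous_expRN_sqrt].
- move=> x; rewrite in_itv /= andbT => ax; rewrite derive1E.
  by have dFx := dF x (lt_trans a0 ax); rewrite derive_val.
Qed.

Lemma expr_le_expR n (u : R) : 0 <= u -> u ^+ n <= n`!%:R * expR u.
Proof.
move=> u0; case: n => [|n]; first by rewrite expr0 fact0 mul1r -expR0 ler_expR.
have := expR_ge1Dxn n u0 => h; rewrite mulrC -ler_pdivrMr ?ltr0n ?fact_gt0 //.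
by apply: le_trans h; rewrite lerDr.
Qed.

(** With u = sqrt t the power of t is u^(d-1); then u^d <= d! e^u and -u^2 <= 1 - 2u. *)
Lemma gamma_integrand_le d (t : R) : 0 < t ->
  t `^ (d.+1%:R / 2 - 1) * expR (- t) <=
  d`!%:R * expR 1 * ((Num.sqrt t)^-1 * expR (- Num.sqrt t)).
Proof.
move=> t0; set u := Num.sqrt t; have u0 : 0 < u by rewrite sqrtr_gt0.
have tu : t = u ^+ 2 by rewrite sqr_sqrtr // ltW.
have -> : t `^ (d.+1%:R / 2 - 1) = u ^+ d / u.
  rewrite {1}tu -powR_mulrn ?ltW // -powRrM.
  have -> : 2 * (d.+1%:R / 2 - 1) = d%:R - 1 :> R by rewrite -natr1; field.
  rewrite powRB; last by apply/implyP => _; rewrite gt_eqF.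
  by rewrite powR_mulrn ?powRr1 // ltW.
have e1 : expR (- t) <= expR 1 * (expR (- u) * expR (- u)).
  rewrite -!expRD ler_expR tu; have := sqr_ge0 (u - 1); rewrite sqrrB1 => h.
  by lra.
have e2 := expr_le_expR d (ltW u0).
have e3 : u ^+ d * expR (- u) <= d`!%:R.
  apply: le_trans (ler_wpM2r (expR_ge0 _) e2) _.
  by rewrite -mulrA expRxMexpNx_1 mulr1.
apply: (@le_trans _ _ (u ^+ d / u * (expR 1 * (expR (- u) * expR (- u))))).
  by rewrite ler_wpM2l // mulr_ge0 ?invr_ge0 ?exprn_ge0 // ltW.
have -> : u ^+ d / u * (expR 1 * (expR (- u) * expR (- u))) =
  (u ^+ d * expR (- u)) * (expR 1 * (u^-1 * expR (- u))) by ring.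
rewrite -(mulrA d`!%:R); apply: ler_wpM2r e3.
by rewrite !mulr_ge0 ?expR_ge0 // invr_ge0 ltW.
Qed.

(** [Gamma] is the finite part of an extended integral, which is 0 by convention if the integral is
    infinite; so finiteness has to be proved as well. The upper bound is uniform on the intervals
    [1/(n+1), +oo[ and passes to their union by monotone convergence. *)
Lemma Gamma_gt0 d : 0 < Gamma (d.+1%:R / 2 : R).
Proof.
rewrite /Gamma /Rintegral.
pose g (t : R) := t `^ (d.+1%:R / 2 - 1) * expR (- t).
have g0 t : 0 <= g t by rewrite mulr_ge0 ?powR_ge0 ?expR_ge0.
have mg : measurable_fun [set: R] g.
  apply: measurable_funM; first exact: measurable_powR.
  apply: (measurableT_comp (@measurable_expR R)); exact: measurable_funN.
have mgD (D : set R) : measurable_fun D (fun t => (g t)%:E).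
  by apply/measurable_EFinP; exact: measurable_funTS.
apply: fine_gt0; apply/andP; split.
  (* On [1, 2] the power of t is at least 1/t >= 1/2, and exp(-t) >= exp(-2). *)
  pose c : R := 2^-1 * expR (- 2).
  have c0 : 0 < c by rewrite mulr_gt0 ?invr_gt0 ?expR_gt0.
  apply: (@lt_le_trans _ _ (\int[mu]_(t in `[1%R, 2%R]) c%:E)%E).
    rewrite integral_cst //= lebesgue_measure_itv /= lte_fin ltr1n /=.
    by rewrite -EFinB -EFinM lte_fin mulr_gt0 //; lra.
  apply: (@le_trans _ _ (\int[mu]_(t in `[1%R, 2%R]) (g t)%:E)%E).
    apply: ge0_le_integral => //=.
    - by move=> t _; rewrite lee_fin ltW.
    - exact: mgD.
    move=> t; rewrite in_itv /= => /andP[t1 t2]; rewrite lee_fin.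
    apply: ler_pM; rewrite ?invr_ge0 ?expR_ge0 //; last by rewrite ler_expR lerN2.
    apply: (@le_trans _ _ (t `^ (- 1))).
      rewrite powR_inv1; last lra.
      by rewrite lef_pV2 // posrE; lra.
    by apply: ler_powR => //; rewrite lerBrDr addNr divr_ge0.
  apply: ge0_subset_integral => //=; first exact: mgD.
  - by move=> t _; rewrite lee_fin.
  - by move=> t /=; rewrite !in_itv /= andbT => /andP[t1 _]; lra.
pose C : R := d`!%:R * expR 1.
have C0 : 0 <= C by rewrite mulr_ge0 ?expR_ge0.
pose D n : set R := `[0 + n.+1%:R^-1, +oo[%classic.
have mD n : measurable (D n) by exact: measurable_itv.
have le_n n : (\int[mu]_(t in D n) (g t)%:E <= (C * 2)%:E)%E.
  have n0 : 0 < 0 + n.+1%:R^-1 :> R by rewrite add0r invr_gt0.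
  pose f x : R := (Num.sqrt x)^-1 * expR (- Num.sqrt x).
  have cw : {within D n, continuous f}.
    apply: continuous_in_subspaceT => x; rewrite inE /D /= in_itv /= andbT => nx.
    by apply: continuous_expR_sqrt; exact: lt_le_trans nx.
  have mf : measurable_fun (D n) f.
    by apply: subspace_continuous_measurable_fun cw; exact: mD.
  apply: (@le_trans _ _ (\int[mu]_(t in D n) (C%:E * (f t)%:E))%E).
    apply: ge0_le_integral => //=; first exact: mD.
    - by move=> t _; rewrite lee_fin.
    - exact: mgD.
    - by apply/measurable_EFinP; apply: measurable_funM.
    - move=> t; rewrite /D /= in_itv /= andbT => tn; rewrite lee_fin.
      by apply: gamma_integrand_le; exact: lt_le_trans tn.
  rewrite ge0_integralZl //=.
  - by rewrite (EFinM C); apply: lee_wpmul2l; rewrite ?lee_fin //;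
    exact: integral_expR_sqrt.
  - exact: mD.
  - exact/measurable_EFinP.
  - by move=> t _; rewrite lee_fin mulr_ge0 ?invr_ge0 ?sqrtr_ge0 ?expR_ge0.
apply: (@le_lt_trans _ _ (C * 2)%:E); last by rewrite ltry.
have cv : (\int[mu]_(t in D n) (g t)%:E)%E @[n --> \oo] -->
    (\int[mu]_(t in \bigcup_n D n) (g t)%:E)%E.
  apply: ge0_nondecreasing_set_cvg_integral => //.
  - move=> m n mn; rewrite subsetEset; apply: subset_itvr; rewrite bnd_simp.
    by rewrite lerD2l lef_pV2 ?posrE // ler_nat.
  - by move=> i; exact: mgD.
  - by move=> i x _; rewrite lee_fin.
by rewrite itvoyEbigcup; apply: cvge_le cv; exact: nearW.
Qed.

End GammaPositive.

(** * The Poisson kernel *)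

Section Kernel.
Variables (R : realType) (d : nat).
Implicit Types (a c u v X Y : 'cV[R]_d) (w : 'M[R]_d) (p : 'cV[R]_d * 'cV[R]_d).

(** Writing 1 for |Y|^2 keeps the value on the sphere and makes the base affine in Y, so that Y may
    leave the sphere along lines. *)
Definition kernel_base w p : R := 1 + dot p.1 p.1 - 2 * dot p.1 (w *m p.2).

Definition kernel_sum (A : {fset 'M[R]_d}) p : R :=
  \sum_(w <- A) \det w * (Num.sqrt (kernel_base w p) ^+ d)^-1.

Lemma elementary_kernel_base D w : elementary D (kernel_base w).
Proof.
have -> : kernel_base w = fun p =>
    1 + dot p.1 (1%:M *m p.1) + (- 2 * dot p.1 (w *m p.2)).
  by apply/funext => p; rewrite mul1mx mulNr.
apply: elementaryD; first apply: elementaryD; first exact: elementary_cst.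
  exact: (elementary_dot _ true true).
apply: elementaryM; first exact: elementary_cst.
exact: (elementary_dot _ true false).
Qed.

Lemma kernel_base_dist w X Y : w^T *m w = 1%:M ->
  kernel_base w (X, Y) = dot (X - w *m Y) (X - w *m Y) + (1 - dot Y Y).
Proof.
move=> ww; rewrite !(dotBl, dotBr) (dotC (w *m Y) X) dot_orthogonal //.
by rewrite /kernel_base /=; ring.
Qed.

(* Euclidean balls are stable under orthogonal projections fixing [c], as
   [alternating_division] requires; the library's sup-norm balls are not. *)
Definition bidisc c (r : R) : set ('cV[R]_d * 'cV[R]_d) :=
  [set p | dot (p.1 - c) (p.1 - c) < r /\ dot (p.2 - c) (p.2 - c) <= r].

Lemma dot_proj_le a c X : a != 0 -> dot a c = 0 ->
  dot (X - dot a X *: ((dot a a)^-1 *: a) - c) (X - dot a X *: ((dot a a)^-1 *: a) - c)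
  <= dot (X - c) (X - c).
Proof.
move=> a0 ac; have aa : 0 < dot a a by rewrite dot_gt0.
have -> : dot a X = dot a (X - c) by rewrite dotBr ac subr0.
rewrite addrAC; move: (X - c) => u.
rewrite scalerA; set k := _ / _.
have ka : k * dot a a = dot a u by rewrite /k divfK // gt_eqF.
have -> : dot (u - k *: a) (u - k *: a) = dot u u - k * (k * dot a a).
  by rewrite !(dotBl, dotBr, dotZl, dotZr) (dotC u a) ka; ring.
by rewrite gerBl mulrA mulr_ge0 ?dot_ge0 // -expr2 sqr_ge0.
Qed.

Lemma dot_convex c X Y (t : R) : 0 < t <= 1 ->
  dot ((1 - t) *: X + t *: Y - c) ((1 - t) *: X + t *: Y - c) <=
  (1 - t) * dot (X - c) (X - c) + t * dot (Y - c) (Y - c).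
Proof.
move=> /andP[t0 t1]; 
have -> : (1 - t) *: X + t *: Y - c = (1 - t) *: (X - c) + t *: (Y - c).
  by rewrite !scalerBr addrACA -opprD -scalerDl subrK scale1r.
move: (X - c) (Y - c) => u v.
rewrite -subr_ge0.
have -> : (1 - t) * dot u u + t * dot v v -
    dot ((1 - t) *: u + t *: v) ((1 - t) *: u + t *: v) =
    t * (1 - t) * dot (u - v) (u - v).
  by rewrite !(dotDl, dotDr, dotNl, dotNr, dotZl, dotZr) (dotC v u); ring.
by rewrite !mulr_ge0 ?dot_ge0 ?subr_ge0 // ltW.
Qed.

Lemma bidisc_absorbing c (r : R) (u : 'cV[R]_d * 'cV[R]_d) : 0 < r ->
  exists2 e : R, 0 < e & bidisc c r ((c, c) + e *: u).
Proof.
move=> r0; set q := dot u.1 u.1 + dot u.2 u.2.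
have q1 : dot u.1 u.1 <= q by rewrite lerDl dot_ge0.
have q2 : dot u.2 u.2 <= q by rewrite lerDr dot_ge0.
have q0 : 0 <= q by rewrite addr_ge0 ?dot_ge0.
have s0 : 0 < 1 + r + q by lra.
pose e := r / (1 + r + q).
have e0 : 0 < e by rewrite divr_gt0.
have e1 : e <= 1 by rewrite ler_pdivrMr // mul1r; lra.
have eq : e * q < r.
  by rewrite /e mulrAC ltr_pdivrMr // ltr_pM2l //; lra.
have key (x : 'cV[R]_d) : dot x x <= q -> dot (c + e *: x - c) (c + e *: x - c) < r.
  move=> xq; rewrite addrC addKr dotZl dotZr; apply: le_lt_trans eq.
  apply: (@le_trans _ _ (e * dot x x)); last by rewrite ler_pM2l.
  by rewrite ler_pM2l // ler_piMl ?dot_ge0.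
by exists e => //; split => /=; [exact: key|apply/ltW/key].
Qed.

Lemma bidisc_nbhs c (U : set ('cV[R]_d * 'cV[R]_d)) : nbhs (c, c) U ->
  exists2 r : R, 0 < r & bidisc c r `<=` U.
Proof.
(* The radius of [bidisc] bounds squared distances. Coordinates are bounded by the Euclidean norm,
   and e/2 makes the inequality strict. *)
move=> /nbhs_ballP[e /= e0 eU]; exists ((e / 2) ^+ 2).
  by rewrite exprn_gt0 // divr_gt0.
have key (x : 'cV[R]_d) : dot (x - c) (x - c) <= (e / 2) ^+ 2 -> ball c e x.
  move=> xe; split=> // i j; rewrite /ball /= ord1 distrC.
  apply: (@le_lt_trans _ _ (e / 2)); last by rewrite ltr_pdivrMr // ltr_pMr // ltr1n.
  suff : (x i 0 - c i 0) ^+ 2 <= (e / 2) ^+ 2.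
    have e2 : 0 <= e / 2 by rewrite divr_ge0 // ltW.
    by move=> h; rewrite -[leRHS](ger0_norm e2) -!sqrtr_sqr ler_wsqrtr.
  apply: le_trans _ xe; rewrite /dot (bigD1 i) //= !mxE.
  by rewrite -expr2 lerDl sumr_ge0 // => k _; rewrite -expr2 sqr_ge0.
by move=> p [p1 p2]; apply: eU; split; apply: key => //; exact: ltW.
Qed.

Lemma bidisc_convex c r p q (t : R) : bidisc c r p -> bidisc c r q -> 0 < t <= 1 ->
  bidisc c r ((1 - t) *: p + t *: q).
Proof.
move=> [p1 p2] [q1 q2] t01; have /andP[t0 t1] := t01.
have s0 : 0 <= 1 - t by rewrite subr_ge0.
split.
  apply: le_lt_trans (dot_convex _ _ _ t01) _.
  rewrite [ltRHS](_ : r = (1 - t) * r + t * r); last by ring.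
  by rewrite ler_ltD // ?ltr_pM2l // ler_wpM2l // ltW.
apply: le_trans (dot_convex _ _ _ t01) _.
rewrite [leRHS](_ : r = (1 - t) * r + t * r); last by ring.
by rewrite lerD // ler_wpM2l // ltW.
Qed.

Lemma bidisc_proj c r a s p : a != 0 -> dot a c = 0 -> bidisc c r p ->
  bidisc c r (p - dot a (side s p) *: inject s ((dot a a)^-1 *: a)).
Proof.
move=> a0 ac [p1 p2]; case: s; split; rewrite /= ?scaler0 ?subr0 //.
  by apply: le_lt_trans p1; exact: dot_proj_le.
by apply: le_trans p2; exact: dot_proj_le.
Qed.

Section Quotient.
Variables (S : {fset 'cV[R]_d}) (H : 'cV[R]_d).
Hypothesis hS : root_subsystem S.
Local Notation P := [fset a in S | 0 < dot a H]%fset.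

(** Meant for A = W' with c = 0 and for the complement of W' in W with c = Y0. Stability of A under
    reflections on both sides makes the sum vanish on every root hyperplane, in X and in Y. *)
Lemma kernel_sum_quotient (A : {fset 'M[R]_d}) c r : 0 < r ->
  {in S, forall a, dot a c = 0} ->
  {in S, forall a w, w \in A -> reflection a *m w \in A /\ w *m reflection a \in A} ->
  {in A, forall w p, bidisc c r p -> 0 < kernel_base w p} ->
  exists2 g, elementary (bidisc c r) g &
    forall p, bidisc c r p -> kernel_sum A p = root_prod P p.1 * root_prod P p.2 * g p.
Proof.
move=> r0 Sc SA Apos.
have PS a : a \in P -> a \in S by rewrite !inE => /andP[].
apply: (alternating_division (c := (c, c)) hS).
- by move=> a /PS aS s p; apply: bidisc_proj; [exact: rsub_neq0 aS|exact: Sc].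
- by move=> a /PS aS []; exact: Sc.
- by move=> p q t; exact: bidisc_convex.
- by move=> u; exact: bidisc_absorbing.
- apply: elementary_sum => w wA; apply: elementaryM; first exact: elementary_cst.
  apply: elementaryV.
    by apply/elementaryX/elementary_sqrt; [exact: elementary_kernel_base|exact: Apos].
  by move=> p Dp; rewrite exprn_gt0 // sqrtr_gt0 Apos.
- move=> a /PS aS s p Dp ap; have a0 := rsub_neq0 hS aS.
  pose G (x : R) := (Num.sqrt (1 + dot p.1 p.1 - 2 * x) ^+ d)^-1.
  case: s ap => ap.
    by apply: (alternating_suml (a := a) G) => // w /(SA a aS)[].
  by apply: (alternating_sumr (a := a) G) => // w /(SA a aS)[].
Qed.

End Quotient.
End Kernel.

(** The remainder is of order n + 1, which leaves a factor t after the division by t^n. *)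
Lemma radial_power_remainder_cvg (R : realType) (d n : nat) (a h : R) : 0 < a ->
  (radial_power d a (t * h) - \sum_(k < n.+1) taylor_coef d a k * (t * h) ^+ k) / t ^+ n
    @[t --> (0 : R)^'+] --> (0 : R).
Proof.
move=> a0; have [C C0 hC] := radial_power_taylor n.+1 d a0.
apply/norm_cvg0P; pose M := C * `|h| ^+ n.+1.
apply: (@squeeze_cvgr _ _ _ _ (fun=> 0) (fun t => M * t)); last 2 first.
- exact: cvg_cst.
- rewrite -[X in _ --> X](mulr0 M); apply: cvg_at_right_filter.
  by apply: cvgM; [exact: cvg_cst|exact: filter.cvg_id].
near=> t; rewrite normr_ge0 /=.
have t0 : 0 < t by near: t; exact: nbhs_right_gt.
have th : `|t * h| <= a / 4.
  have th0 : t * `|h| <= a / 4.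
    have h1 : 0 < `|h| + 1 by rewrite ltr_wpDl.
    have : t <= a / 4 / (`|h| + 1).
      by near: t; apply: nbhs_right_le; rewrite !divr_gt0.
    rewrite ler_pdivlMr // => /(le_trans _); apply.
    by rewrite ler_pM2l // lerDl.
  by rewrite normrM gtr0_norm.
rewrite normrM normfV normrX (gtr0_norm t0) ler_pdivrMr ?exprn_gt0 //.
apply: le_trans (hC _ th) _; rewrite normrM (gtr0_norm t0) exprMn /M.
by rewrite (exprS t) (_ : C * _ = C * `|h| ^+ n.+1 * t * t ^+ n) //; ring.
Unshelve. all: by end_near. Qed.

(** A small move in a regular direction leaves all root hyperplanes; singular points are
    approximated in this way. *)
Lemma near_root_prod_neq0 (R : realType) (d : nat) (S : {fset 'cV[R]_d}) (X H : 'cV[R]_d) :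
  (forall a, a \in S -> dot a H != 0) ->
  \forall t \near (0 : R)^'+, root_prod S (X + t *: H) != 0.
Proof.
move=> SH; rewrite /root_prod; have : forall s : seq 'cV[R]_d,
    {in s, forall a, dot a H != 0} ->
    \forall t \near (0 : R)^'+, \prod_(a <- s) dot a (X + t *: H) != 0.
  elim=> [_|a s IHs sH].
    by apply: nearW => t; rewrite big_nil oner_eq0.
  have aH := sH a (mem_head _ _).
  have ax : \forall t \near (0 : R)^'+, dot a (X + t *: H) != 0.
    have [aX|aX] := eqVneq (dot a X) 0.
      near=> t; have t0 : 0 < t by near: t; exact: nbhs_right_gt.
      by rewrite dotDr dotZr aX add0r mulf_neq0 // gt_eqF.
    apply: cvgr_neq0 aX; under eq_fun => t do rewrite dotDr dotZr.
    apply: cvg_at_right_filter; rewrite -[X in _ --> X]addr0.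
    rewrite -[X in _ --> _ + X](mul0r (dot a H)).
    by apply: cvgD; [exact: cvg_cst|apply: cvgM;
      [exact: filter.cvg_id|exact: cvg_cst]].
  have sx := IHs (fun b bs => sH b (@mem_behead _ (a :: s) b bs)).
  by near=> t; rewrite big_cons mulf_neq0 //; near: t.
by apply.
Unshelve. all: by end_near. Qed.

(** * The contribution of the stabilizer *)

Section LeadingTerm.
Variables (R : realType) (d : nat) (S : {fset 'cV[R]_d}) (H Y0 : 'cV[R]_d).
Hypothesis hS : root_subsystem S.
Hypothesis Hreg : forall a, a \in S -> dot a H != 0.
Hypothesis Wfin : finite_set (weyl_group S).
Hypothesis SY : forall a, a \in S -> dot a Y0 = 0.
Hypothesis YY : dot Y0 Y0 = 1.
Local Notation W := (fset_set (weyl_group S)).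
Local Notation P := [fset a in S | 0 < dot a H]%fset.
Implicit Types X Z : 'cV[R]_d.

Variable g : 'cV[R]_d * 'cV[R]_d -> R.
Hypothesis eg : elementary (bidisc 0 1) g.
Hypothesis gE : forall p, bidisc 0 1 p ->
  kernel_sum W p = root_prod P p.1 * root_prod P p.2 * g p.

Lemma weyl_fix w : weyl_group S w -> w *m Y0 = Y0.
Proof.
elim/weyl_ind => [|a v aS _ IH]; first by rewrite mul1mx.
by rewrite -mulmxA IH reflection_fix // SY.
Qed.

Lemma dot_sub_gt0 X : dot X X < 1 -> 0 < dot (X - Y0) (X - Y0).
Proof.
by move=> X1; rewrite dot_gt0 subr_eq0; apply: contraTneq X1 => ->; rewrite YY ltxx.
Qed.

(** When there are roots, [gE] gives no information at Y0 itself, where their product vanishes. It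
    is used at Y0 + t Z, divided by t^n, and t tends to 0. *)
Lemma leading_term_regular X : dot X X < 1 -> root_prod P X != 0 ->
  g (X, Y0) = taylor_coef d (dot (X - Y0) (X - Y0)) #|` P| *
    (#|` P|)`!%:R / root_prod P (half_sum P).
Proof.
move=> X1 PX; set a := dot (X - Y0) (X - Y0); set n := #|` P|.
have a0 : 0 < a by exact: dot_sub_gt0.
(* [Z0] is a regular point of the closed unit ball and Z leads to it from Y0, so Y0 + t Z stays in
   that ball for 0 < t <= 1. Its root values are t times those of [Z0], because the roots vanish at
   Y0. *)
have [e e0 [_ He]] := bidisc_absorbing 0 (0, H) (@ltr01 R).
rewrite /= subr0 add0r in He.
set Z0 := e *: H in He; pose Z := Z0 - Y0.
have PZ0 : root_prod P Z0 != 0.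
  by rewrite root_prodZ mulf_neq0 ?expf_neq0 ?(gt_eqF e0) // root_prod_regular.
have PZ : root_prod P Z = root_prod P Z0.
  rewrite /root_prod; apply: eq_big_seq => b; rewrite !inE => /andP[bS _].
  by rewrite /Z dotBr SY // subr0.
pose Y t := Y0 + t *: Z.
have PY t : root_prod P (Y t) = t ^+ n * root_prod P Z0.
  rewrite -PZ -root_prodZ /root_prod; apply: eq_big_seq => b;
    rewrite !inE => /andP[bS _].
  by rewrite /Y dotDr SY // add0r.
have DY t : 0 < t <= 1 -> bidisc 0 1 (X, Y t).
  move=> t01; have D0 : bidisc 0 1 (X, Y0) by split; rewrite /= subr0 // YY.
  have D1 : bidisc 0 1 (X, Z0) by split; rewrite /= subr0.
  have := bidisc_convex D0 D1 t01; congr (bidisc _ _ _).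
  rewrite /Y /Z /=; congr pair; first by rewrite -scalerDl subrK scale1r.
  by rewrite scalerBl scale1r scalerBr addrAC addrA.
have kY w t : weyl_group S w ->
    (Num.sqrt (kernel_base w (X, Y t)) ^+ d)^-1 = radial_power d a (t * dot X (w *m Z)).
  move=> Ww; rewrite /radial_power /kernel_base /Y /= mulmxDr weyl_fix // -scalemxAr.
  congr ((Num.sqrt _ ^+ d)^-1); rewrite dotDr dotZr /a.
  by rewrite !(dotBl, dotBr) YY (dotC Y0 X); ring.
have lim1 : g (X, Y t) @[t --> (0 : R)^'+] --> g (X, Y0).
  have Y0E : Y 0 = Y0 by rewrite /Y scale0r addr0.
  have c0 : Y t @[t --> (0 : R)^'+] --> Y0.
    rewrite -[X in _ --> X]Y0E; apply: cvg_at_right_filter.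
    by apply: cvgD; [exact: cvg_cst|apply: cvgZr_tmp; exact: filter.cvg_id].
  have c1 : (X : 'cV[R]_d) @[t --> (0 : R)^'+] --> X by exact: cvg_cst.
  have cp : (X, Y t) @[t --> (0 : R)^'+] --> (X, Y0) by exact: (cvg_pair c1 c0).
  apply: continuous_cvg cp; apply: (elementary_continuous eg).
  by split; rewrite /= subr0 // YY.
have lim2 : \sum_(w <- W) \det w * ((radial_power d a (t * dot X (w *m Z)) -
    \sum_(k < n.+1) taylor_coef d a k * (t * dot X (w *m Z)) ^+ k) / t ^+ n)
    @[t --> (0 : R)^'+] --> (0 : R).
  rewrite [X in _ --> X](_ : 0 = \sum_(w <- W) \det w * 0); last first.
    by rewrite big1 // => w _; rewrite mulr0.
  apply: cvg_big => [|w _]; first exact: add_continuous.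
  by apply: cvgM; [exact: cvg_cst|exact: radial_power_remainder_cvg].
have [hs0 QE] := alternating_powerE hS Hreg Wfin.
have [_ _ Q0] := alternating_power_root_prod H hS Wfin.
pose T := taylor_coef d a n * alternating_power S n X Z.
have sumT t : \sum_(w <- W) \det w * (\sum_(k < n.+1) taylor_coef d a k *
    (t * dot X (w *m Z)) ^+ k) = t ^+ n * T.
  transitivity (\sum_(k < n.+1) taylor_coef d a k * t ^+ k * alternating_power S k X Z).
    under eq_bigr => w _ do rewrite mulr_sumr.
    rewrite exchange_big; apply: eq_bigr => k _ /=.
    rewrite /alternating_power mulr_sumr; apply: eq_bigr => w _.
    by rewrite exprMn; ring.
  rewrite big_ord_recr /= big1 ?add0r => [|k _]; last by rewrite Q0 ?mulr0.
  rewrite /T; move: (t ^+ n) (taylor_coef _ _ _) (alternating_power _ _ _ _) => *.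
  by ring.
have lim3 : root_prod P X * root_prod P Z0 * g (X, Y t) @[t --> (0 : R)^'+] --> T.
  rewrite -[X in _ --> X]add0r.
  apply: cvg_trans (cvgD lim2 (cvg_cst T)); apply: near_eq_cvg; near=> t.
  have t0 : 0 < t by near: t; exact: nbhs_right_gt.
  have t1 : t <= 1 by near: t; apply: nbhs_right_le.
  have tn : t ^+ n != 0 by rewrite expf_neq0 // gt_eqF.
  apply: (mulfI tn) => /=; rewrite fctE.
  have -> : t ^+ n * (root_prod P X * root_prod P Z0 * g (X, Y t)) = kernel_sum W (X, Y t).
    have Dt : bidisc 0 1 (X, Y t) by apply: DY; rewrite t0.
    rewrite (gE Dt) /= PY.
    by move: (t ^+ n) (root_prod P X) (root_prod P Z0) (g _) => *; ring.
  rewrite mulrDr -sumT mulr_sumr -big_split /kernel_sum; apply: eq_big_seq => w.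
  rewrite mem_fset_weyl // => /asboolP Ww; rewrite kY //=.
  have alg (q b r s : R) : q != 0 -> q * (b * ((r - s) / q)) + b * s = b * r.
    by move=> q0; field.
  exact: alg.
have : T = root_prod P X * root_prod P Z0 * g (X, Y0).
  apply: (cvg_unique _ lim3); first exact: norm_hausdorff.
  by apply: cvgM; [exact: cvg_cst|exact: lim1].
rewrite /T QE PZ -/n => e1.
by apply: (mulfI (mulf_neq0 PX PZ0)); rewrite -e1; ring.
Unshelve. all: by end_near. Qed.

(** Both sides are continuous along X + t H, which is regular for small t > 0. *)
Lemma leading_term X : dot X X < 1 ->
  g (X, Y0) = taylor_coef d (dot (X - Y0) (X - Y0)) #|` P| *
    (#|` P|)`!%:R / root_prod P (half_sum P).
Proof.
move=> X1.
pose k Z := taylor_coef d (dot (Z - Y0) (Z - Y0)) #|` P| *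
    (#|` P|)`!%:R / root_prod P (half_sum P).
pose x (t : R) := X + t *: H.
have cx : x t @[t --> (0 : R)^'+] --> X.
  have x0E : x 0 = X by rewrite /x scale0r addr0.
  rewrite -[X in _ --> X]x0E; apply: cvg_at_right_filter.
  by apply: cvgD; [exact: cvg_cst|apply: cvgZr_tmp; exact: filter.cvg_id].
have cdot c : dot (x t - c) (x t - c) @[t --> (0 : R)^'+] --> dot (X - c) (X - c).
  have cc : continuous (fun Z => dot (Z - c) (Z - c)).
    move=> Z; have cB : {for Z, continuous (fun Z => Z - c)}.
      by apply: (@continuousB _ _ _ id (fun=> c));
        [exact: filter.cvg_id|exact: cst_continuous].
    exact: (dot_continuous cB cB).
  exact: (cvg_comp _ _ cx (cc X)).
have lim1 : g (x t, Y0) @[t --> (0 : R)^'+] --> g (X, Y0).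
  have c1 : (Y0 : 'cV[R]_d) @[t --> (0 : R)^'+] --> Y0 by exact: cvg_cst.
  have cp : (x t, Y0) @[t --> (0 : R)^'+] --> (X, Y0) by exact: (cvg_pair cx c1).
  apply: continuous_cvg cp; apply: (elementary_continuous eg).
  by split; rewrite /= subr0 // YY.
have lim2 : k (x t) @[t --> (0 : R)^'+] --> k X.
  have a0 := dot_sub_gt0 X1.
  apply: cvgM; last exact: cvg_cst.
  apply: cvgM; last exact: cvg_cst.
  apply: cvgM; first exact: cvg_cst.
  apply: cvgV; first by rewrite mulf_neq0 ?expf_neq0 ?gt_eqF ?sqrtr_gt0.
  have cs := cvg_comp _ _ (cdot Y0) (@sqrt_continuous R (dot (X - Y0) (X - Y0))).
  apply: cvgM; first exact: (cvg_comp _ _ (cdot Y0) (@exprn_continuous R _ _)).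
  exact: (cvg_comp _ _ cs (@exprn_continuous R _ _)).
apply: (cvg_unique _ lim1); first exact: norm_hausdorff.
apply: cvg_trans lim2; apply: near_eq_cvg.
near=> t; rewrite /k -leading_term_regular //.
  near: t; have := cdot 0; rewrite subr0 => /cvgr_lt /(_ _ X1).
  by apply: filterS => t; rewrite subr0.
by near: t; apply: near_root_prod_neq0 => b; rewrite !inE => /andP[/Hreg].
Unshelve. all: by end_near. Qed.

End LeadingTerm.

(** * Continuous extension of the Poisson kernel *)

Lemma near_all_seq (T : Type) (I : eqType) (F : set_system T) (s : seq I)
    (Q : I -> T -> Prop) : Filter F ->
  {in s, forall i, \forall x \near F, Q i x} -> \forall x \near F, {in s, forall i, Q i x}.
Proof.
move=> FF; elim: s => [|i s IHs] sQ; first exact: filterE.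
apply: filterS2 (sQ i (mem_head _ _)) (IHs _) => [x Qi Qs j|j js].
  by rewrite inE => /predU1P[->|/Qs].
by apply: sQ; rewrite inE js orbT.
Qed.

Lemma perm_fset_split (T : choiceType) (A B : {fset T}) : (B `<=` A)%fset ->
  perm_eq A ((B : seq T) ++ (A `\` B)%fset).
Proof.
move=> /fsubsetP BA; apply: uniq_perm; first exact: fset_uniq.
  rewrite cat_uniq !fset_uniq /= andbT; apply/hasPn => x.
  by rewrite in_fsetD => /andP[].
move=> x; rewrite mem_cat in_fsetD; by case: (boolP (x \in B)) => [/BA ->|_].
Qed.

Section PoissonKernel.
Variables (R : realType) (d : nat).
Implicit Types (X Y : 'cV[R]_d) (S : {fset 'cV[R]_d}).

Lemma root_prod_continuous S : continuous (root_prod S).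
Proof.
apply: continuous_big => [|a _ X]; first exact: mul_continuous.
by apply: dot_continuous; [exact: cst_continuous|exact: filter.cvg_id].
Qed.

Lemma root_prod_split S S' X : (S' `<=` S)%fset ->
  root_prod S X = root_prod S' X * root_prod (S `\` S')%fset X.
Proof. by move=> SS; rewrite /root_prod (perm_big _ (perm_fset_split SS)) big_cat.
  Qed.

Lemma kernel_sum_split (A B : {fset 'M[R]_d}) p : (B `<=` A)%fset ->
  kernel_sum A p = kernel_sum B p + kernel_sum (A `\` B)%fset p.
Proof. by move=> BA; rewrite /kernel_sum (perm_big _ (perm_fset_split BA)) big_cat.
  Qed.

Lemma enorm_lt1 X : (enorm X < 1) = (dot X X < 1).
Proof. by rewrite /enorm -[X in _ < X]sqrtr1 ltr_sqrt. Qed.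

Lemma enorm_eq1 X : (enorm X = 1) <-> (dot X X = 1).
Proof.
rewrite /enorm; split=> [h|->]; last exact: sqrtr1.
by rewrite -(sqr_sqrtr (dot_ge0 X)) h expr1n.
Qed.

Lemma enorm_sqr X : enorm X ^+ 2 = dot X X.
Proof. by rewrite sqr_sqrtr // dot_ge0. Qed.

Lemma poisson_formulaE (S SP : {fset 'cV[R]_d}) X Y :
  root_subsystem S -> finite_set (weyl_group S) -> dot Y Y = 1 ->
  poisson_formula S SP X Y = (1 - enorm X ^+ 2) /
    ((weyl_order S)%:R * sphere_area R d * root_prod SP X * root_prod SP Y) *
    kernel_sum (fset_set (weyl_group S)) (X, Y).
Proof.
move=> hS Wfin YY; rewrite /poisson_formula fsbig_finite //; congr (_ * _).
apply: eq_big_seq => w; rewrite mem_fset_weyl // => /asboolP Ww.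
by rewrite kernel_base_dist ?(weyl_tr_mul hS) // YY subrr addr0.
Qed.

(** Needed for the limit in [poisson_kernel] to be unique. Regular pairs near (X, Y) arise by moving
    both points in the direction H and normalizing the second back to the sphere. *)
Lemma regular_pairs_proper (SP : {fset 'cV[R]_d}) (H X Y : 'cV[R]_d) :
  (forall a, a \in SP -> dot a H != 0) -> dot X X < 1 -> dot Y Y = 1 ->
  ProperFilter (within (regular_pairs SP) (nbhs (X, Y))).
Proof.
move=> SPH X1 Y1.
have cH (Z : 'cV[R]_d) : Z + t *: H @[t --> (0 : R)^'+] --> Z.
  have ZE : Z + 0 *: H = Z by rewrite scale0r addr0.
  rewrite -[X in _ --> X]ZE; apply: cvg_at_right_filter.
  by apply: cvgD; [exact: cvg_cst|apply: cvgZr_tmp; exact: filter.cvg_id].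
have dot_cvg (Z : 'cV[R]_d) :
    dot (Z + t *: H) (Z + t *: H) @[t --> (0 : R)^'+] --> dot Z Z.
  have cc : {for Z, continuous (fun x : 'cV[R]_d => dot x x)}.
    by apply: dot_continuous; exact: filter.cvg_id.
  exact: (cvg_comp _ _ (cH Z) cc).
have cn : (enorm (Y + t *: H))^-1 @[t --> (0 : R)^'+] --> (1 : R).
  rewrite -[X in _ --> X]invr1; apply: cvgV; first exact: oner_neq0.
  rewrite -[X in _ --> X]sqrtr1 -Y1.
  exact: (cvg_comp _ _ (dot_cvg Y) (@sqrt_continuous R (dot Y Y))).
have cY : (enorm (Y + t *: H))^-1 *: (Y + t *: H) @[t --> (0 : R)^'+] --> Y.
  by rewrite -[X in _ --> X]scale1r; apply: cvgZ; [exact: cn|exact: cH].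
have cp : (X + t *: H, (enorm (Y + t *: H))^-1 *: (Y + t *: H)) @[t --> (0 : R)^'+]
    --> (X, Y) by exact: (cvg_pair (cH X) cY).
apply: Build_ProperFilter_ex => A /cp nA.
near (0 : R)^'+ => t.
exists (X + t *: H, (enorm (Y + t *: H))^-1 *: (Y + t *: H)).
have dY : 0 < dot (Y + t *: H) (Y + t *: H).
  by near: t; apply: (cvgr_gt _ (dot_cvg Y)); rewrite Y1.
have nY : (enorm (Y + t *: H))^-1 != 0.
  by rewrite invr_eq0 gt_eqF // sqrtr_gt0.
have nearA : regular_pairs SP (X + t *: H, (enorm (Y + t *: H))^-1 *: (Y + t *: H)) ->
    A (X + t *: H, (enorm (Y + t *: H))^-1 *: (Y + t *: H)) by near: t.
apply: nearA; split => /=.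
- rewrite /unit_ball /= enorm_lt1; near: t; exact: (cvgr_lt _ (dot_cvg X)).
- rewrite /unit_sphere /=; apply/enorm_eq1; rewrite dotZl dotZr -enorm_sqr; field.
  by rewrite -invr_eq0.
- by near: t; exact: near_root_prod_neq0.
- rewrite root_prodZ mulf_neq0 ?expf_neq0 //.
  by near: t; exact: near_root_prod_neq0.
Unshelve. all: by end_near. Qed.

End PoissonKernel.

Lemma taylor_coef_leading (R : realType) (d : nat) (S : {fset 'cV[R]_d}) (X : 'cV[R]_d) :
  X != 0 ->
  taylor_coef d (dot X X) #|` S| * (#|` S|)`!%:R / root_prod S (half_sum S) =
  2 ^+ (2 * #|` S|) * pochhammer (d%:R / 2) #|` S| /
    root_prod S (\sum_(a <- S) a) / enorm X ^+ (2 * #|` S| + d).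
Proof.
move=> X0; have a0 : 0 < dot X X by rewrite dot_gt0.
have s0 : Num.sqrt (dot X X) != 0 by rewrite gt_eqF // sqrtr_gt0.
have an : dot X X ^+ #|` S| != 0 by rewrite expf_neq0 // gt_eqF.
have sn : Num.sqrt (dot X X) ^+ d != 0 by rewrite expf_neq0.
have f0 : (#|` S|)`!%:R != 0 :> R by rewrite pnatr_eq0 -lt0n fact_gt0.
have t0 : 2 ^+ #|` S| != 0 :> R by rewrite expf_neq0.
rewrite /taylor_coef /half_sum root_prodZ exprVn exprD (exprM (enorm X)) enorm_sqr.
rewrite mulnC exprM expr2 /enorm.
(* If this product is 0, both sides are 0, as 1/0 = 0. *)
have [->|r0] := eqVneq (root_prod S (\sum_(a <- S) a)) 0.
  by rewrite !(mulr0, invr0, mul0r).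
move: (root_prod _ _) (pochhammer _ _) (dot X X ^+ _) (Num.sqrt _ ^+ _)
  (_`!%:R) (2 ^+ _) r0 an sn f0 t0 => r p a s f t r0 an sn f0 t0.
by field; rewrite ?r0 ?an ?sn ?f0 ?t0.
Qed.

Lemma root_system_subsystem (R : realType) (d : nat) (S : {fset 'cV[R]_d}) :
  root_system S -> root_subsystem S.
Proof.
move=> hS; split; [exact: root_neq0|exact: root_reflection|exact: root_integral|].
exact: root_reduced.
Qed.

(** * Asymptotics of the kernel at a boundary point *)

Theorem theorem3p11 (R : realType) (d : nat) (Sigma SigmaP : {fset 'cV[R]_d})
    (Y0 : 'cV[R]_d)
    (hSigma : root_system Sigma) (hSigmaP : positive_roots Sigma SigmaP)
    (hY0 : unit_sphere Y0) :
  let SigmaP' := (roots_vanishing Sigma Y0 `&` SigmaP)%fset in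
  let gamma' := #|` SigmaP'| in
  let rho' := \sum_(a <- SigmaP') a in
  let pi' := root_prod SigmaP' in
  let pi'' := root_prod (SigmaP `\` SigmaP')%fset in
  (fun X : 'cV[R]_d =>
     poisson_kernel Sigma SigmaP X Y0 /
     (2 ^+ (2 * gamma') * pochhammer (d%:R / 2) gamma' /
        ((weyl_order Sigma)%:R * sphere_area R d * pi' rho' * pi'' Y0 ^+ 2) *
      ((1 - enorm X ^+ 2) / enorm (X - Y0) ^+ (2 * gamma' + d))))
    @ within (@unit_ball R d) (nbhs Y0) --> (1 : R).
Proof.
have hS := root_system_subsystem hSigma.
have Wfin : finite_set (weyl_group Sigma) := weyl_finite hS (root_span hSigma).
have YY : dot Y0 Y0 = 1 by apply/enorm_eq1.
have [H [Hreg eSP]] := hSigmaP.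
(* A unit vector exists only for d > 0. This enters Gamma(d/2) > 0, the Pochhammer factor and the
   vanishing of |X - Y0|^m at X = Y0. *)
have d0 : (0 < d)%N.
  case: (posnP d) => // e; move: YY; rewrite /dot big1 => [/esym/eqP|i _].
    by rewrite oner_eq0.
  by have := ltn_ord i; rewrite {2}e.
set S' := roots_vanishing Sigma Y0.
have hS' : root_subsystem S' by exact: roots_vanishing_subsystem.
have mS' a : (a \in S') = (a \in Sigma) && (dot a Y0 == 0) by exact: mem_roots_vanishing.
have Hreg' a : a \in S' -> dot a H != 0 by rewrite mS' => /andP[/Hreg].
have SY a : a \in S' -> dot a Y0 = 0 by rewrite mS' => /andP[_ /eqP].
have S'S : (S' `<=` Sigma)%fset by apply/fsubsetP => a; rewrite mS' => /andP[].
have WW := weyl_subset S'S.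
have Wfin' : finite_set (weyl_group S') by exact: sub_finite_set WW Wfin.
pose P := [fset a in S' | 0 < dot a H]%fset.
have eP : (S' `&` SigmaP)%fset = P.
  apply/fsetP => a; rewrite eSP in_fsetI !in_fset !inE /=.
  by case: (a \in Sigma).
have PSP : (P `<=` SigmaP)%fset by rewrite -eP fsubsetIr.
cbv zeta; rewrite eP.
set n := #|` P|; set pi' := root_prod P; set pi'' := root_prod _.
set rho := \sum_(a <- P) a.
pose N : R := (weyl_order Sigma)%:R * sphere_area R d.
have N0 : N != 0.
  rewrite mulf_neq0 //.
    rewrite pnatr_eq0 -lt0n /weyl_order cardfs_gt0; apply/fset0Pn; exists 1%:M.
    by rewrite mem_fset_weyl //; apply/asboolP; exact: weyl1.
  rewrite /sphere_area -(prednK d0) !mulf_neq0 ?invr_eq0 ?gt_eqF ?powR_gt0 ?pi_gt0 //.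
  exact: Gamma_gt0.
have pi''Y : pi'' Y0 != 0.
  rewrite /pi'' /root_prod big_seq prodf_seq_neq0; apply/allP => a aP.
  apply/implyP; rewrite in_fsetD -eP in_fsetI mS' => /andP[+ aSP].
  rewrite aSP andbT; move: aSP; rewrite eSP !inE => /andP[-> _].
  by [].
set W := fset_set (weyl_group Sigma); set W' := fset_set (weyl_group S').
have mW w : (w \in W) = `[< weyl_group Sigma w >] by exact: mem_fset_weyl.
have mW' w : (w \in W') = `[< weyl_group S' w >] by exact: mem_fset_weyl.
have W'W : (W' `<=` W)%fset.
  by apply/fsubsetP => w; rewrite mW mW' => /asboolP h; apply/asboolP/WW.
have stab' a w : a \in S' -> (reflection a *m w \in W') = (w \in W') /\
    (w *m reflection a \in W') = (w \in W').
  move=> aS; have Wa := weyl_reflection aS; have a0 := rsub_neq0 hS' aS.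
  rewrite !mW'; split; apply/asboolP/asboolP => Ww; try exact: weylM.
    by rewrite -(mul1mx w) -(reflectionK a0) -mulmxA; exact: weylM.
  by rewrite -(mulmx1 w) -(reflectionK a0) mulmxA; exact: weylM.
have stab a w : a \in S' -> w \in W ->
    reflection a *m w \in W /\ w *m reflection a \in W.
  move=> aS; have Wa := WW _ (weyl_reflection aS).
  by rewrite !mW => /asboolP Ww; split; apply/asboolP; exact: weylM.
(* Unit balls, open in X so that X differs from every w Y with |Y| = 1, and closed in Y so as to
   contain Y0. *)
have [g1 eg1 g1E] : exists2 g, elementary (bidisc 0 1) g & forall p, bidisc 0 1 p ->
    kernel_sum W' p = root_prod P p.1 * root_prod P p.2 * g p.
  apply: kernel_sum_quotient => //.
  - by move=> a _; rewrite dot0r.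
  - by move=> a aS w wW; have [-> ->] := stab' a w aS.
  - move=> w; rewrite mW' => /asboolP Ww [X Y] [/=]; rewrite !subr0 => X1 Y1.
    have ww := weyl_tr_mul hS' Ww; rewrite kernel_base_dist //.
    move: Y1; rewrite le_eqVlt => /predU1P[Y1|Y1].
      rewrite Y1 subrr addr0 dot_gt0 subr_eq0; apply: contraTneq X1 => ->.
      by rewrite dot_orthogonal // Y1 ltxx.
    by rewrite ltr_wpDl ?dot_ge0 // subr_gt0.
(* By Steinberg's theorem each w outside [W'] moves Y0, so its base is positive at (Y0, Y0) and,
   there being finitely many w, all are positive on a common neighbourhood. *)
have [r r0 rpos] : exists2 r : R, 0 < r & forall p, bidisc Y0 r p ->
    {in (W `\` W')%fset, forall w, 0 < kernel_base w p}.
  apply: bidisc_nbhs.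
  apply: (near_all_seq (Q := fun w p =>
    0 < kernel_base w p) (nbhs_filter (Y0, Y0))) => w.
  rewrite in_fsetD mW' mW => /andP[/asboolPn nW /asboolP Ww].
  have wY : w *m Y0 <> Y0.
    by move=> wY; apply: nW; exact: weyl_stabilizer hS Wfin Hreg Ww wY.
  have k0 : 0 < kernel_base w (Y0, Y0).
    rewrite kernel_base_dist ?(weyl_tr_mul hS) // YY subrr addr0 dot_gt0 subr_eq0.
    by apply/eqP => /esym.
  have := elementary_continuous (elementary_kernel_base setT w) (x := (Y0, Y0)) I.
  by move=> /cvgr_gt /(_ _ k0).
have [g2 eg2 g2E] : exists2 g, elementary (bidisc Y0 r) g & forall p, bidisc Y0 r p ->
    kernel_sum (W `\` W')%fset p = root_prod P p.1 * root_prod P p.2 * g p.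
  apply: kernel_sum_quotient => //.
    move=> a aS w; rewrite !in_fsetD => /andP[wW' wW].
    by have [-> ->] := stab' a w aS; have [-> ->] := stab a w aS wW; rewrite wW'.
  by move=> w wW p Dp; exact: rpos.
have piE X : root_prod SigmaP X = pi' X * pi'' X by exact: root_prod_split.
have pkE X : dot X X < 1 -> dot (X - Y0) (X - Y0) < r -> pi'' X != 0 ->
    poisson_kernel Sigma SigmaP X Y0 =
    (1 - enorm X ^+ 2) / (N * pi'' X * pi'' Y0) * (g1 (X, Y0) + g2 (X, Y0)).
  move=> X1 Xr piX.
  have SPH a : a \in SigmaP -> dot a H != 0 by rewrite eSP !inE => /andP[/Hreg].
  have PF := regular_pairs_proper SPH X1 YY.
  have D1 : bidisc 0 1 (X, Y0) by split; rewrite /= subr0 // YY.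
  have D2 : bidisc Y0 r (X, Y0) by split; rewrite //= subrr dot0l ltW.
  (* The Poisson formula after cancelling pi'(X) pi'(Y). It is continuous at (X, Y0), so its value
     there is the limit over regular pairs. *)
  pose F (p : 'cV[R]_d * 'cV[R]_d) := (1 - enorm p.1 ^+ 2) /
    (N * pi'' p.1 * pi'' p.2) * (g1 p + g2 p).
  have Fc : {for (X, Y0), continuous F}.
    have c1 : {for (X, Y0), continuous (fun p : 'cV[R]_d * 'cV[R]_d =>
      p.1)} by exact: cvg_fst.
    have c2 : {for (X, Y0), continuous (fun p : 'cV[R]_d * 'cV[R]_d =>
      p.2)} by exact: cvg_snd.
    apply: cvgM.
      apply: cvgM.
        apply: cvgB; first exact: cvg_cst.
        under eq_fun => p do rewrite enorm_sqr.
        by rewrite enorm_sqr; exact: (dot_continuous c1 c1).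
      apply: cvgV; first exact: (mulf_neq0 (mulf_neq0 N0 piX) pi''Y).
      apply: cvgM; last exact: (cvg_comp _ _ c2 (@root_prod_continuous _ _ _ Y0)).
      apply: cvgM; first exact: cvg_cst.
      exact: (cvg_comp _ _ c1 (@root_prod_continuous _ _ _ X)).
    by apply: cvgD;
      [exact: (elementary_continuous eg1)|exact: (elementary_continuous eg2)].
  apply: cvg_lim; first exact: norm_hausdorff.
  have Fw : F @ within (regular_pairs SigmaP) (nbhs (X, Y0)) --> F (X, Y0).
    by apply: cvg_within_filter; exact: Fc.
  apply: cvg_trans Fw; apply: near_eq_cvg.
  have nY : \forall p \near (X, Y0), dot (p.2 - Y0) (p.2 - Y0) < r.
    have : {for (X, Y0), continuous (fun p : 'cV[R]_d * 'cV[R]_d =>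
        dot (p.2 - Y0) (p.2 - Y0))}.
      have cB : {for (X, Y0), continuous (fun p : 'cV[R]_d * 'cV[R]_d => p.2 - Y0)}.
        by apply: (@continuousB _ _ _ snd (fun=> Y0));
          [exact: cvg_snd|exact: cst_continuous].
      exact: (dot_continuous cB cB).
    by move=> /cvgr_lt; apply; rewrite /= subrr dot0l.
  have nX : \forall p \near (X, Y0), dot (p.1 - Y0) (p.1 - Y0) < r.
    have : {for (X, Y0), continuous (fun p : 'cV[R]_d * 'cV[R]_d =>
        dot (p.1 - Y0) (p.1 - Y0))}.
      have cB : {for (X, Y0), continuous (fun p : 'cV[R]_d * 'cV[R]_d => p.1 - Y0)}.
        by apply: (@continuousB _ _ _ fst (fun=> Y0));
          [exact: cvg_fst|exact: cst_continuous].
      exact: (dot_continuous cB cB).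
    by move=> /cvgr_lt; apply.
  apply: filterS2 nX nY => -[x y] /= xr yr [/= x1 y1 rx ry].
  have {}x1 : dot x x < 1 by rewrite -enorm_lt1.
  have {}y1 : dot y y = 1 by apply/enorm_eq1.
  rewrite poisson_formulaE // (kernel_sum_split _ W'W) g1E; last first.
    by split; rewrite /= subr0 // y1.
  rewrite g2E; last by split; rewrite //= ltW.
  move: rx ry; rewrite !piE !mulf_eq0 !negb_or => /andP[x' x''] /andP[y' y''].
  rewrite /F /= -/N -/(pi' x) -/(pi' y); field.
  by rewrite N0 x' x'' y' y''.
pose m := (2 * n + d)%N.
have g1v X : dot X X < 1 -> g1 (X, Y0) =
    2 ^+ (2 * n) * pochhammer (d%:R / 2) n / pi' rho / enorm (X - Y0) ^+ m.
  move=> X1; rewrite (leading_term hS' Hreg' Wfin' SY YY eg1 g1E X1).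
  by rewrite taylor_coef_leading // -dot_gt0 dot_sub_gt0.
pose K : R := 2 ^+ (2 * n) * pochhammer (d%:R / 2) n / pi' rho.
have rho0 : pi' rho != 0.
  have [h _] := alternating_powerE hS' Hreg' Wfin'.
  by move: h; rewrite /half_sum root_prodZ mulf_eq0 negb_or => /andP[].
have poch0 : pochhammer (d%:R / 2 : R) n != 0.
  rewrite /pochhammer prodf_seq_neq0; apply/allP => i _.
  by rewrite gt_eqF // ltr_pwDl // divr_gt0 // ltr0n.
have K0 : K != 0 by rewrite !mulf_neq0 ?invr_eq0 // expf_neq0.
(* The quotient of the two sides for X in the ball near Y0. As g1(X, Y0) = K / |X - Y0|^m, its
   contribution is 1, and that of [g2] tends to 0 because m > 0. The first factor compensates for
   pi''(X) having been replaced by pi''(Y0). *)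
pose F X := pi'' Y0 / pi'' X * (1 + g2 (X, Y0) * enorm (X - Y0) ^+ m / K).
have DY : bidisc Y0 r (Y0, Y0) by split; rewrite /= subrr dot0l // ltW.
have cB : {for Y0, continuous (fun X : 'cV[R]_d => X - Y0)}.
  by apply: (@continuousB _ _ _ id (fun=> Y0));
    [exact: filter.cvg_id|exact: cst_continuous].
have cdot : {for Y0, continuous (fun X : 'cV[R]_d => dot (X - Y0) (X - Y0))}.
  exact: (dot_continuous cB cB).
have Fc : F X @[X --> Y0] --> F Y0.
  have cpi : pi'' X @[X --> Y0] --> pi'' Y0 by exact: root_prod_continuous.
  have cg : g2 (X, Y0) @[X --> Y0] --> g2 (Y0, Y0).
    have cp : (X, Y0) @[X --> Y0] --> (Y0, Y0).
      exact: (cvg_pair (@filter.cvg_id _ (nbhs Y0)) (@cst_continuous _ _ Y0 Y0)).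
    exact: (cvg_comp _ _ cp (elementary_continuous eg2 DY)).
  have ce : enorm (X - Y0) ^+ m @[X --> Y0] --> enorm (Y0 - Y0) ^+ m.
    have cs := cvg_comp _ _ cdot (@sqrt_continuous R _).
    exact: (cvg_comp _ _ cs (@exprn_continuous R m _)).
  exact: (cvgM (cvgM (cvg_cst _) (cvgV pi''Y cpi))
    (cvgD (cvg_cst _) (cvgM (cvgM cg ce) (cvg_cst _)))).
have FY : F Y0 = 1.
  rewrite /F divff // subrr /enorm dot0l sqrtr0 expr0n /m addn_eq0.
  by rewrite (gtn_eqF d0) andbF mulr0 mul0r addr0 mulr1.
have Fw : F @ within (@unit_ball R d) (nbhs Y0) --> (1 : R).
  by rewrite -[X in _ --> X]FY; apply: cvg_within_filter; exact: Fc.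
apply: cvg_trans Fw; apply: near_eq_cvg.
have nr : \forall X \near Y0, dot (X - Y0) (X - Y0) < r.
  by move: cdot => /cvgr_lt; apply; rewrite /= subrr dot0l.
have np : \forall X \near Y0, pi'' X != 0.
  have cpi : pi'' X @[X --> Y0] --> pi'' Y0 by exact: root_prod_continuous.
  exact: (cvgr_neq0 _ cpi pi''Y).
apply: filterS2 nr np => X Xr piX; rewrite /unit_ball /= enorm_lt1 => X1.
rewrite pkE // g1v // -/K -/m -/N /F.
have E0 : enorm (X - Y0) ^+ m != 0.
  by rewrite expf_neq0 // /enorm gt_eqF // sqrtr_gt0 dot_sub_gt0.
have B0 : 1 - enorm X ^+ 2 != 0 by rewrite enorm_sqr subr_eq0 gt_eqF.
have -> : 2 ^+ (2 * n) * pochhammer (d%:R / 2) n / (N * pi' rho * pi'' Y0 ^+ 2) =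
    K / (N * pi'' Y0 ^+ 2).
  have alg (t q M y : R) : q != 0 -> M != 0 -> y != 0 ->
      t / (M * q * y ^+ 2) = t / q / (M * y ^+ 2).
    by move=> q0 M0 y0; field; rewrite q0 M0 y0.
  exact: alg.
move: (enorm (X - Y0) ^+ m) (1 - enorm X ^+ 2) (K) (g2 _) E0 B0 K0 (N) N0 =>
  E B k g E0 B0 k0 M M0.
by field; rewrite M0 pi''Y piX E0 B0 k0.
Qed.
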